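(* Let $P=P_1|P_2|\dots|P_k$ be a network of $\pi_a$-calculus processes. Suppose the associated hypergraph $H(P)$ admits an automorphism $\sigma\neq \mathit{id}$ that has exactly one orbit (i.e. $O_\sigma(i)=\{1,\dots,k\}$ for every node $i$), and that $P$ is symmetric with respect to $\sigma$. Then $P$ is not an electoral system.
   Context: Syntax and semantics of the $\pi_a$-calculus: names from a countable set $\mathcal N$ that contains the natural numbers and a distinguished name $o$; processes $P ::= \bar{x}y \mid x(y).P \mid \nu x P \mid P|P \mid !P$, with the standard early labelled transition system of the $\pi$-calculus (rules Out, In, Open, Res, Par, Com, Close, Rep, and closure under structural congruence, which includes alpha-conversion, commutativity and associativity of $|$, and scope extrusion $(\nu xP)|Q\equiv\nu x(P|Q)$ for $x\notin\mathit{fn}(Q)$). Restrictions created by Close are pushed to the top level of the network, and the network never performs a visible action on a name restricted at top level. Network and computation: a network is $P=P_1|\dots|P_k$; a computation $C$ is a finite or $\omega$-infinite sequence of transitions $P=P^0\xrightarrow{\mu^0}P^1\xrightarrow{\mu^1}\cdots$ where each $P^m=P^m_1|\dots|P^m_k$. $C'$ extends $C$ if $C$ is a prefix of $C'$. The projection $\mathit{Proj}(C,P_i)$ is the sequence of the $i$-th components' transitions: at step $m$, if the step is derived by Par from a transition of component $i$ then it contributes that transition; if derived by Com or Close with a premise that is a transition of component $i$, it contributes that premise; if component $i$ is idle it contributes nothing. Electoral system: $P=P_1|\dots|P_k$ is electoral if for every computation $C$ of $P$ there is an extension $C'$ of $C$ and an $n\in\{1,\dots,k\}$ such that for each $i$,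 $\mathit{Proj}(C',P_i)$ contains an output action $\bar{o}n$, and no extension of $C'$ contains any action $\bar{o}m$ with $m\neq n$. Hypergraph: $H=\langle N,X,t\rangle$ with finite sets $N$ (nodes), $X$ (arcs) and $t$ assigning to each arc a set of nodes. The hypergraph of a network is $H(P)=\langle\{1,\dots,k\},\ \mathit{fn}(P)\setminus\{o\},\ t\rangle$ with $t(x)=\{n : x\in \mathit{fn}(P_n)\}$. An automorphism is a pair $\sigma=\langle\sigma_N,\sigma_X\rangle$ of permutations of $N$ and $X$ with $t(\sigma_X(x))=\sigma_N(t(x))$ for all $x$. The orbit of $n$ is $O_\sigma(n)=\{n,\sigma(n),\dots,\sigma^{h-1}(n)\}$ where $\sigma^h=\mathit{id}$. Symmetry: for a process $Q$, $\sigma(Q)$ is obtained by first alpha-renaming bound names to fresh names, then renaming every free name by $\sigma$ (acting as $\sigma_X$ on arcs, as $\sigma_N$ on node identifiers, identity on all other names including $o$ and the fresh bound names), homomorphically on all constructs. $P$ is symmetric with respect to $\sigma$ if $P_{\sigma(i)}\equiv_\alpha \sigma(P_i)$ for every node $i$. *)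

(* Defs.v *)
From Stdlib Require Import List Arith PeanoNat.
Import ListNotations.

(* Names: a countable set containing the naturals and a distinguished o *)
Inductive name : Type :=
| NNat : nat -> name
| NO   : name
| NVar : nat -> name.

Definition name_eq_dec (a b : name) : {a = b} + {a <> b}.
Proof. decide equality; apply Nat.eq_dec. Defined.

(* Processes.  [Nil] is only needed as the residual of an output.       *)
Inductive proc : Type :=
| Nil  : proc
| Out  : name -> name -> proc
| Inp  : name -> name -> proc -> proc  (* x(y).P, y bound in P *)
| Res  : name -> proc -> proc
| Par  : proc -> proc -> proc
| Rep  : proc -> proc.

Fixpoint free_in (x : name) (p : proc) : Prop :=
  match p with
  | Nil => False
  | Out a b => x = a \/ x = b
  | Inp a b q => x = a \/ (x <> b /\ free_in x q)
  | Res a q => x <> a /\ free_in x q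
  | Par p q => free_in x p \/ free_in x q
  | Rep q => free_in x q
  end.

Fixpoint bound_in (x : name) (p : proc) : Prop :=
  match p with
  | Nil | Out _ _ => False
  | Inp _ b q => x = b \/ bound_in x q
  | Res a q => x = a \/ bound_in x q
  | Par p q => bound_in x p \/ bound_in x q
  | Rep q => bound_in x q
  end.

Fixpoint occurs (x : name) (p : proc) : Prop :=
  match p with
  | Nil => False
  | Out a b => x = a \/ x = b
  | Inp a b q => x = a \/ x = b \/ occurs x q
  | Res a q => x = a \/ occurs x q
  | Par p q => occurs x p \/ occurs x q
  | Rep q => occurs x q
  end.

(* naive substitution of z for the free occurrences of y;
   capture-free whenever z is not bound in p *)
Fixpoint subst (z y : name) (p : proc) : proc :=
  let rn a := if name_eq_dec a y then z else a in
  match p with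
  | Nil => Nil
  | Out a b => Out (rn a) (rn b)
  | Inp a b q => Inp (rn a) b (if name_eq_dec b y then q else subst z y q)
  | Res a q => Res a (if name_eq_dec a y then q else subst z y q)
  | Par p q => Par (subst z y p) (subst z y q)
  | Rep q => Rep (subst z y q)
  end.

(* apply a renaming f to the free names (bound names are left untouched);
   capture-free whenever bound names are outside the range of f *)
Definition fupd (f : name -> name) (b : name) : name -> name :=
  fun x => if name_eq_dec x b then b else f x.

Fixpoint rename (f : name -> name) (p : proc) : proc :=
  match p with
  | Nil => Nil
  | Out a b => Out (f a) (f b)
  | Inp a b q => Inp (f a) b (rename (fupd f b) q)
  | Res a q => Res a (rename (fupd f a) q)
  | Par p q => Par (rename f p) (rename f q)
  | Rep q => Rep (rename f q)
  end.

Inductive alpha : proc -> proc -> Prop :=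
| al_refl p : alpha p p
| al_sym p q : alpha p q -> alpha q p
| al_trans p q r : alpha p q -> alpha q r -> alpha p r
| al_in x y y' p : ~ occurs y' p -> alpha (Inp x y p) (Inp x y' (subst y' y p))
| al_res y y' p : ~ occurs y' p -> alpha (Res y p) (Res y' (subst y' y p))
| al_cin x y p q : alpha p q -> alpha (Inp x y p) (Inp x y q)
| al_cres y p q : alpha p q -> alpha (Res y p) (Res y q)
| al_cparl p p' q : alpha p p' -> alpha (Par p q) (Par p' q)
| al_cparr p q q' : alpha q q' -> alpha (Par p q) (Par p q')
| al_crep p q : alpha p q -> alpha (Rep p) (Rep q).

Inductive scong : proc -> proc -> Prop :=
| sc_alpha p q : alpha p q -> scong p q
| sc_sym p q : scong p q -> scong q p
| sc_trans p q r : scong p q -> scong q r -> scong p r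
| sc_comm p q : scong (Par p q) (Par q p)
| sc_assoc p q r : scong (Par (Par p q) r) (Par p (Par q r))
| sc_extr x p q : ~ free_in x q -> scong (Par (Res x p) q) (Res x (Par p q))
| sc_cin x y p q : scong p q -> scong (Inp x y p) (Inp x y q)
| sc_cres y p q : scong p q -> scong (Res y p) (Res y q)
| sc_cparl p p' q : scong p p' -> scong (Par p q) (Par p' q)
| sc_cparr p q q' : scong q q' -> scong (Par p q) (Par p q')
| sc_crep p q : scong p q -> scong (Rep p) (Rep q).

Inductive label : Type :=
| Tau   : label
| LIn   : name -> name -> label
| LOut  : name -> name -> label
| LBOut : name -> name -> label.

Definition lab_names (mu : label) : list name :=
  match mu with
  | Tau => []
  | LIn x z => [x; z]
  | LOut x y => [x; y]
  | LBOut x y => [x; y]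
  end.

Definition lab_bn (mu : label) : list name :=
  match mu with LBOut _ y => [y] | _ => [] end.

Inductive trans : proc -> label -> proc -> Prop :=
| t_out x y : trans (Out x y) (LOut x y) Nil
| t_in x y z p : ~ bound_in z p -> trans (Inp x y p) (LIn x z) (subst z y p)
| t_open x y p p' : trans p (LOut x y) p' -> x <> y -> trans (Res y p) (LBOut x y) p'
| t_res y p mu p' : trans p mu p' -> ~ In y (lab_names mu) ->
    trans (Res y p) mu (Res y p')
| t_par p q mu p' : trans p mu p' -> (forall b, In b (lab_bn mu) -> ~ free_in b q) ->
    trans (Par p q) mu (Par p' q)
| t_com p q x y p' q' : trans p (LOut x y) p' -> trans q (LIn x y) q' ->
    trans (Par p q) Tau (Par p' q')
| t_close p q x y p' q' : trans p (LBOut x y) p' -> trans q (LIn x y) q' ->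
    ~ free_in y q -> trans (Par p q) Tau (Res y (Par p' q'))
| t_rep p mu p' : trans (Par p (Rep p)) mu p' -> trans (Rep p) mu p'
| t_cong p q mu q' p' : scong p q -> trans q mu q' -> scong q' p' -> trans p mu p'.

(* Networks P = P_1 | ... | P_k.  Components are indexed 1..k (node i is
   component i, and its identifier is the name NNat i).  A network state is
   ν rs (P_1 | ... | P_k), where rs are the names restricted at top level
   (created by Close).  *)
Record nstate : Type := NS { nres : list name; ncomp : nat -> proc }.

Definition upd (c : nat -> proc) (i : nat) (p : proc) : nat -> proc :=
  fun j => if Nat.eq_dec j i then p else c j.

Definition contrib : Type := nat -> option (proc * label * proc).

Definition one_contrib (i : nat) (t : proc * label * proc) : contrib :=
  fun j => if Nat.eq_dec j i then Some t else None.

Definition two_contrib (i : nat) (ti : proc * label * proc)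
  (j : nat) (tj : proc * label * proc) : contrib :=
  fun l => if Nat.eq_dec l i then Some ti else
           if Nat.eq_dec l j then Some tj else None.

Definition node (k i : nat) : Prop := 1 <= i <= k.

Inductive nstep (k : nat) : nstate -> label -> contrib -> nstate -> Prop :=
| ns_par rs c i mu p' :
    node k i -> trans (c i) mu p' ->
    (forall x, In x (lab_names mu) -> ~ In x rs) ->
    (forall b, In b (lab_bn mu) -> forall j, node k j -> j <> i -> ~ free_in b (c j)) ->
    nstep k (NS rs c) mu (one_contrib i (c i, mu, p')) (NS rs (upd c i p'))
| ns_com rs c i j x y pi' pj' :
    node k i -> node k j -> i <> j ->
    trans (c i) (LOut x y) pi' -> trans (c j) (LIn x y) pj' ->
    nstep k (NS rs c) Tau
      (two_contrib i (c i, LOut x y, pi') j (c j, LIn x y, pj'))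
      (NS rs (upd (upd c i pi') j pj'))
| ns_close rs c i j x y pi' pj' :
    node k i -> node k j -> i <> j ->
    trans (c i) (LBOut x y) pi' -> trans (c j) (LIn x y) pj' ->
    (* y fresh for the other components and the top-level restrictions,
       so that the new restriction can be pushed to the top level *)
    ~ In y rs -> (forall l, node k l -> l <> i -> ~ free_in y (c l)) ->
    nstep k (NS rs c) Tau
      (two_contrib i (c i, LBOut x y, pi') j (c j, LIn x y, pj'))
      (NS (y :: rs) (upd (upd c i pi') j pj')).

(* Computations: finite ([clen = Some n], n steps) or omega-infinite
   ([clen = None]) sequences of network transitions. *)
Record comp : Type := Comp {
  clen : option nat;
  cst  : nat -> nstate;
  clab : nat -> label;
  ccon : nat -> contrib
}.

Definition step_in (l : option nat) (m : nat) : Prop :=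
  match l with None => True | Some n => m < n end.

Definition is_comp (k : nat) (P : nat -> proc) (C : comp) : Prop :=
  cst C 0 = NS [] P /\
  forall m, step_in (clen C) m ->
    nstep k (cst C m) (clab C m) (ccon C m) (cst C (S m)).

Definition len_le (l l' : option nat) : Prop :=
  match l, l' with
  | _, None => True
  | Some a, Some b => a <= b
  | None, Some _ => False
  end.

Definition extends (C C' : comp) : Prop :=
  len_le (clen C) (clen C') /\ cst C 0 = cst C' 0 /\
  forall m, step_in (clen C) m ->
    clab C m = clab C' m /\ ccon C m = ccon C' m /\ cst C (S m) = cst C' (S m).

Definition proj_has_out (C : comp) (i : nat) (v : name) : Prop :=
  exists m p p', step_in (clen C) m /\ ccon C m i = Some (p, LOut NO v, p').

Definition electoral (k : nat) (P : nat -> proc) : Prop :=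
  forall C, is_comp k P C ->
  exists C', is_comp k P C' /\ extends C C' /\
  exists n, node k n /\
    (forall i, node k i -> proj_has_out C' i (NNat n)) /\
    (forall C'', is_comp k P C'' -> extends C' C'' ->
       forall i v, proj_has_out C'' i v -> v = NNat n).

(* Hypergraph H(P) = <{1..k}, fn(P)\{o}, t> *)
Definition arc (k : nat) (P : nat -> proc) (x : name) : Prop :=
  x <> NO /\ exists i, node k i /\ free_in x (P i).

Definition tmap (k : nat) (P : nat -> proc) (x : name) (n : nat) : Prop :=
  node k n /\ free_in x (P n).

Definition automorphism (k : nat) (P : nat -> proc)
  (sN : nat -> nat) (sX : name -> name) : Prop :=
  (forall i, node k i -> node k (sN i)) /\
  (forall i j, node k i -> node k j -> sN i = sN j -> i = j) /\
  (forall j, node k j -> exists i, node k i /\ sN i = j) /\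
  (forall x, arc k P x -> arc k P (sX x)) /\
  (forall x y, arc k P x -> arc k P y -> sX x = sX y -> x = y) /\
  (forall y, arc k P y -> exists x, arc k P x /\ sX x = y) /\
  (forall x, arc k P x -> forall n,
     tmap k P (sX x) n <-> exists m, tmap k P x m /\ n = sN m).

Definition is_identity (k : nat) (P : nat -> proc)
  (sN : nat -> nat) (sX : name -> name) : Prop :=
  (forall i, node k i -> sN i = i) /\ (forall x, arc k P x -> sX x = x).

Definition single_orbit (k : nat) (sN : nat -> nat) : Prop :=
  forall i j, node k i -> node k j -> exists m, Nat.iter m sN i = j.

Definition sigma_renaming (k : nat) (P : nat -> proc)
  (sN : nat -> nat) (sX : name -> name) (f : name -> name) : Prop :=
  forall x,
    (forall i, x = NNat i -> node k i -> f x = NNat (sN i)) /\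
    ((forall i, x = NNat i -> ~ node k i) -> arc k P x -> f x = sX x) /\
    ((forall i, x = NNat i -> ~ node k i) -> ~ arc k P x -> f x = x).

Definition fresh_name (k : nat) (P : nat -> proc) (b : name) : Prop :=
  b <> NO /\ (forall i, b = NNat i -> ~ node k i) /\
  (forall i, node k i -> ~ free_in b (P i)).

Definition sigma_image (k : nat) (P : nat -> proc)
  (sN : nat -> nat) (sX : name -> name) (Q R : proc) : Prop :=
  exists f Q', sigma_renaming k P sN sX f /\ alpha Q Q' /\
    (forall b, bound_in b Q' -> fresh_name k P b) /\
    R = rename f Q'.

Definition symmetric (k : nat) (P : nat -> proc)
  (sN : nat -> nat) (sX : name -> name) : Prop :=
  forall i, node k i ->
    exists R, sigma_image k P sN sX (P i) R /\ alpha (P (sN i)) R.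

(* Main.v *)
From Stdlib Require Import List Arith PeanoNat Lia Classical IndefiniteDescription.
Require Import Defs.
Import ListNotations.

(* Outputs of the asynchronous calculus are not prefixes, so an output and an
   input of the same component commute. Hence from a symmetric state every
   step can be replayed by all components of the orbit, one after the other:
   a component may have to receive before it sends, or conversely, but by the
   diamond property the result is the same, and the state is symmetric again.
   If the network were electoral, such rounds could be chained into an infinite
   computation in which every announcement of [n] comes with an announcement
   of [sigma n], which differs from [n].

   One permutation [pi] of all names, of order [k], serves for all rounds: it
   extends [sigma] by infinitely many [k]-cycles of unused names, and a bound
   output is alpha-converted so as to extrude a name from an unused cycle. *)

(** * Name permutations and alpha-conversion *)

(** The main obstacle is the rule [t_cong]: structural congruence may wrap a derivation anywhere, so
    transitions cannot be inverted. The diamond, however, needs inversion on one side only. The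
    input is treated by induction on its derivation in [trans], congruence steps included; only the
    output is replaced by a syntax-directed relation [emit], shown to be stable under [scong].

    That the permutation has order [k] is not given: with a single orbit of nodes, the [k]-th power
    of an automorphism may still permute arcs that join the same nodes. It follows from symmetry,
    since no nontrivial renaming of the free names of a process leaves it alpha-equivalent to
    itself. The hypothesis that sigma is not the identity enters only to give [2 <= k], whence sigma
    moves every node.

    The election hypothesis serves twice. It excludes a symmetric state from which nothing can move,
    so every round has a step to replay; and it contradicts the infinite computation, which has no
    proper extension and would have to contain the election itself. *)

Definition inj (f : name -> name) : Prop := forall x y, f x = f y -> x = y.

(* Unlike [rename], [act] also moves the bound names, so it is compatible
   with every construction as soon as [f] is injective. *)
Fixpoint act (f : name -> name) (p : proc) : proc :=
  match p with
  | Nil => Nil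
  | Out a b => Out (f a) (f b)
  | Inp a b q => Inp (f a) (f b) (act f q)
  | Res a q => Res (f a) (act f q)
  | Par p q => Par (act f p) (act f q)
  | Rep q => Rep (act f q)
  end.

Definition lact (f : name -> name) (l : label) : label :=
  match l with
  | Tau => Tau
  | LIn x y => LIn (f x) (f y)
  | LOut x y => LOut (f x) (f y)
  | LBOut x y => LBOut (f x) (f y)
  end.

Definition swap (a b x : name) : name :=
  if name_eq_dec x a then b else if name_eq_dec x b then a else x.

Ltac swp := unfold swap in *; repeat destruct name_eq_dec; subst; try congruence.

Ltac ne := intros ?E; subst; simpl in *; intuition congruence.

Lemma swap_inj a b : inj (swap a b).
Proof. intros x y; swp. Qed.

Lemma swap_l a b : swap a b a = b.
Proof. swp. Qed.

Lemma swap_r a b : swap a b b = a.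
Proof. swp. Qed.

Lemma swap_other a b x : x <> a -> x <> b -> swap a b x = x.
Proof. swp. Qed.

Lemma swap_invol a b x : swap a b (swap a b x) = x.
Proof. swp. Qed.

Lemma inj_comp f g : inj f -> inj g -> inj (fun x => f (g x)).
Proof. intros Hf Hg x y H; auto. Qed.

Lemma inj_id : inj (fun x => x).
Proof. intros x y H; exact H. Qed.

Lemma act_comp f g p : act f (act g p) = act (fun x => f (g x)) p.
Proof. induction p; simpl; congruence. Qed.

Lemma act_id f p : (forall x, f x = x) -> act f p = p.
Proof. intros H; induction p; simpl; rewrite ?H; congruence. Qed.

Lemma act_swap_invol a b p : act (swap a b) (act (swap a b) p) = p.
Proof. rewrite act_comp; apply act_id, swap_invol. Qed.

Lemma lact_swap_invol a b l : lact (swap a b) (lact (swap a b) l) = l.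
Proof. destruct l; simpl; rewrite ?swap_invol; reflexivity. Qed.

Lemma lab_names_lact f l : lab_names (lact f l) = map f (lab_names l).
Proof. destruct l; reflexivity. Qed.

Lemma lab_bn_lact f l : lab_bn (lact f l) = map f (lab_bn l).
Proof. destruct l; reflexivity. Qed.

Lemma lab_bn_names l x : In x (lab_bn l) -> In x (lab_names l).
Proof. destruct l; simpl; tauto. Qed.

Lemma lact_swap_fresh a b l :
  ~ In a (lab_names l) -> ~ In b (lab_names l) -> lact (swap a b) l = l.
Proof.
  destruct l; simpl; intros; rewrite ?swap_other; auto; ne.
Qed.

Lemma in_map_inj f x l : inj f -> In (f x) (map f l) <-> In x l.
Proof.
  intros Hf; split; intros H.
  - apply in_map_iff in H as [y [E H]]; apply Hf in E; subst; exact H.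
  - apply in_map; exact H.
Qed.

Lemma occurs_act f p x : inj f -> occurs (f x) (act f p) <-> occurs x p.
Proof.
  intros Hf; assert (E : forall a b, f a = f b <-> a = b)
    by (split; [apply Hf | congruence]).
  induction p; simpl; rewrite ?E; tauto.
Qed.

Lemma bound_act f p x : inj f -> bound_in (f x) (act f p) <-> bound_in x p.
Proof.
  intros Hf; assert (E : forall a b, f a = f b <-> a = b)
    by (split; [apply Hf | congruence]).
  induction p; simpl; rewrite ?E; tauto.
Qed.

Lemma free_act f p x : inj f -> free_in (f x) (act f p) <-> free_in x p.
Proof.
  intros Hf; assert (E : forall a b, f a = f b <-> a = b)
    by (split; [apply Hf | congruence]).
  induction p; simpl; rewrite ?E; tauto.
Qed.

Lemma free_act_preimage f p y : free_in y (act f p) -> exists x, y = f x /\ free_in x p.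
Proof.
  induction p as [|a b|a b p IH|a p IH|p IHp q IHq|p IH]; simpl; intros H.
  - tauto.
  - destruct H as [-> | ->]; eauto.
  - destruct H as [-> | [Hn H]]; [eauto|].
    destruct (IH H) as [x [-> Hx]]; exists x; split; [reflexivity|].
    right; split; [congruence | exact Hx].
  - destruct H as [Hn H].
    destruct (IH H) as [x [-> Hx]]; exists x; split; [reflexivity|].
    split; [congruence | exact Hx].
  - destruct H as [H | H]; [destruct (IHp H) as [x []] | destruct (IHq H) as [x []]]; eauto.
  - exact (IH H).
Qed.

Lemma free_swap a b p x : free_in x (act (swap a b) p) <-> free_in (swap a b x) p.
Proof.
  rewrite <- (free_act (swap a b) p) by apply swap_inj.
  rewrite swap_invol; tauto.
Qed.

Lemma free_occurs x p : free_in x p -> occurs x p.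
Proof. induction p; simpl; tauto. Qed.

Fixpoint nms (p : proc) : list name :=
  match p with
  | Nil => []
  | Out a b => [a; b]
  | Inp a b q => a :: b :: nms q
  | Res a q => a :: nms q
  | Par p q => nms p ++ nms q
  | Rep q => nms q
  end.

Lemma occurs_nms x p : occurs x p -> In x (nms p).
Proof.
  induction p; simpl; rewrite ?in_app_iff; intuition congruence.
Qed.

Lemma free_nms x p : free_in x p -> In x (nms p).
Proof. intros H; apply occurs_nms, free_occurs, H. Qed.

Lemma nvar_bound (L : list name) : exists N, forall n, In (NVar n) L -> n < N.
Proof.
  induction L as [|a L [N HN]].
  - exists 0; intros n [].
  - destruct a as [m| |m]; try (exists N; intros n [E|H]; [discriminate | auto]).
    exists (S m + N); intros n [E|H]; [injection E; lia | specialize (HN n H); lia].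
Qed.

Lemma exists_fresh (L : list name) : exists c, ~ In c L.
Proof.
  destruct (nvar_bound L) as [N HN]; exists (NVar N); intros H.
  specialize (HN N H); lia.
Qed.

Lemma subst_act f y' y p : inj f -> act f (subst y' y p) = subst (f y') (f y) (act f p).
Proof.
  intros Hf.
  assert (R : forall a, f (if name_eq_dec a y then y' else a) =
                        if name_eq_dec (f a) (f y) then f y' else f a).
  { intros a; repeat destruct name_eq_dec; subst; auto.
    - congruence.
    - apply Hf in e; congruence. }
  induction p as [|a b|a b p IH|a p IH|p IHp q IHq|p IH]; simpl; rewrite ?R; try congruence.
  - f_equal; repeat destruct name_eq_dec; subst; auto; try congruence.
    apply Hf in e; congruence.
  - f_equal; repeat destruct name_eq_dec; subst; auto; try congruence.
    apply Hf in e; congruence.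
Qed.

Lemma alpha_act f p q : inj f -> alpha p q -> alpha (act f p) (act f q).
Proof.
  intros Hf; induction 1; simpl.
  - apply al_refl.
  - apply al_sym; auto.
  - eapply al_trans; eauto.
  - rewrite subst_act by auto; apply al_in; rewrite occurs_act; auto.
  - rewrite subst_act by auto; apply al_res; rewrite occurs_act; auto.
  - apply al_cin; auto.
  - apply al_cres; auto.
  - apply al_cparl; auto.
  - apply al_cparr; auto.
  - apply al_crep; auto.
Qed.

Lemma alpha_par p p' q q' : alpha p p' -> alpha q q' -> alpha (Par p q) (Par p' q').
Proof.
  intros Hp Hq; eapply al_trans; [apply al_cparl, Hp | apply al_cparr, Hq].
Qed.

(** A binder equal to [a] stops the substitution, whereas the swap renames it to [c]; as [c] is
    fresh, one alpha step reconciles the two. *)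
Lemma subst_alpha_swap c a p : ~ occurs c p -> alpha (subst c a p) (act (swap a c) p).
Proof.
  assert (R : forall x, x <> c -> (if name_eq_dec x a then c else x) = swap a c x)
    by (intros x Hx; swp).
  induction p as [|x y|x y p IH|x p IH|p IHp q IHq|p IH]; simpl; intros H.
  - apply al_refl.
  - rewrite !R by ne; apply al_refl.
  - rewrite R by ne.
    destruct (name_eq_dec y a) as [->|Hy].
    + rewrite swap_l; eapply al_trans; [apply (al_in _ _ c); tauto | apply al_cin, IH; tauto].
    + rewrite (swap_other a c y) by (auto; ne).
      apply al_cin, IH; tauto.
  - destruct (name_eq_dec x a) as [->|Hx].
    + rewrite swap_l; eapply al_trans; [apply (al_res _ c); tauto | apply al_cres, IH; tauto].
    + rewrite (swap_other a c x) by (auto; ne).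
      apply al_cres, IH; tauto.
  - apply alpha_par; tauto.
  - apply al_crep; tauto.
Qed.

(* Both binders are moved to a common fresh name, where the two renamings
   agree again on the free names of the body. *)
Lemma act_agree_alpha p : forall f g, inj f -> inj g ->
  (forall x, free_in x p -> f x = g x) -> alpha (act f p) (act g p).
Proof.
  assert (B : forall (q : proc) (y : name) (f g : name -> name),
    (forall f g, inj f -> inj g ->
      (forall x, free_in x q -> f x = g x) -> alpha (act f q) (act g q)) ->
    inj f -> inj g -> (forall x, x <> y /\ free_in x q -> f x = g x) ->
    exists c, ~ occurs c (act f q) /\ ~ occurs c (act g q) /\
      alpha (subst c (f y) (act f q)) (subst c (g y) (act g q))).
  { intros q y f g IH Hf Hg E.
    destruct (exists_fresh (nms (act f q) ++ nms (act g q))) as [c Hc].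
    rewrite in_app_iff in Hc.
    assert (Hcf : ~ occurs c (act f q)) by (intros H; apply occurs_nms in H; tauto).
    assert (Hcg : ~ occurs c (act g q)) by (intros H; apply occurs_nms in H; tauto).
    exists c; repeat split; auto.
    eapply al_trans; [apply subst_alpha_swap; auto|].
    eapply al_trans; [|apply al_sym, subst_alpha_swap; auto].
    rewrite !act_comp; apply IH.
    - apply inj_comp; auto using swap_inj.
    - apply inj_comp; auto using swap_inj.
    - intros x Hx; destruct (name_eq_dec x y) as [->|Hxy]; [rewrite !swap_l; reflexivity|].
      assert (Ex : f x = g x) by auto.
      assert (f x <> f y) by (intros K; apply Hf in K; auto).
      assert (g x <> g y) by (intros K; apply Hg in K; auto).
      assert (f x <> c) by (intros K; apply Hcf; rewrite <- K; apply occurs_act; auto using free_occurs).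
      rewrite !swap_other; congruence. }
  induction p as [|a b|a b p IH|a p IH|p IHp q IHq|p IH]; simpl; intros f g Hf Hg E.
  - apply al_refl.
  - rewrite (E a), (E b) by tauto; apply al_refl.
  - rewrite (E a) by tauto.
    destruct (B p b f g IH Hf Hg) as [c [Hcf [Hcg K]]]; [intros; apply E; tauto|].
    eapply al_trans; [apply (al_in _ _ c), Hcf|].
    eapply al_trans; [|apply al_sym, (al_in _ _ c), Hcg].
    apply al_cin, K.
  - destruct (B p a f g IH Hf Hg) as [c [Hcf [Hcg K]]]; [intros; apply E; tauto|].
    eapply al_trans; [apply (al_res _ c), Hcf|].
    eapply al_trans; [|apply al_sym, (al_res _ c), Hcg].
    apply al_cres, K.
  - apply alpha_par; auto.
  - apply al_crep; auto.
Qed.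

Lemma act_fix_alpha f p : inj f -> (forall x, free_in x p -> f x = x) -> alpha (act f p) p.
Proof.
  intros Hf H; rewrite <- (act_id (fun x => x) p) at 2 by reflexivity.
  apply act_agree_alpha; auto using inj_id.
Qed.

Lemma swap_fresh_alpha a b p : ~ free_in a p -> ~ free_in b p -> alpha (act (swap a b) p) p.
Proof.
  intros Ha Hb; apply act_fix_alpha; [apply swap_inj|].
  intros x Hx; apply swap_other; intros E; subst; auto.
Qed.

(** Neither [a] nor [b] is free in the whole restriction, so the swap fixes all its free names. *)
Lemma res_swap_alpha a b p :
  ~ free_in b (Res a p) -> alpha (Res a p) (Res b (act (swap a b) p)).
Proof.
  intros H; apply al_sym.
  eapply al_trans; [|apply (act_fix_alpha (swap a b) (Res a p) (swap_inj a b))].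
  - simpl; rewrite swap_l; apply al_refl.
  - simpl in *; intros x [Hx Hf]; apply swap_other; auto; ne.
Qed.

Lemma free_subst_fresh y' y p x : ~ occurs y' p ->
  (x <> y' /\ free_in x (subst y' y p)) <-> (x <> y /\ x <> y' /\ free_in x p).
Proof.
  assert (R : forall a, (x = if name_eq_dec a y then y' else a) <->
     (a = y /\ x = y') \/ (a <> y /\ x = a)) by (intros a; destruct name_eq_dec; intuition).
  induction p as [|a b|a b p IH|a p IH|p IHp q IHq|p IH]; simpl; intros H; rewrite ?R.
  - tauto.
  - destruct (name_eq_dec x y); subst; intuition (subst; tauto || congruence).
  - destruct (name_eq_dec b y); subst; intuition (subst; tauto || congruence).
  - destruct (name_eq_dec a y); subst; intuition (subst; tauto || congruence).
  - tauto.
  - tauto.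
Qed.

Lemma free_alpha p q x : alpha p q -> free_in x p <-> free_in x q.
Proof.
  induction 1 as [| | |a y y' p Hn|y y' p Hn| | | | |]; simpl; try tauto.
  - pose proof (free_subst_fresh y' y p x Hn).
    destruct (name_eq_dec x y') as [->|]; [|tauto].
    assert (~ free_in y' p) by (intros K; apply Hn, free_occurs, K); tauto.
  - pose proof (free_subst_fresh y' y p x Hn).
    destruct (name_eq_dec x y') as [->|]; [|tauto].
    assert (~ free_in y' p) by (intros K; apply Hn, free_occurs, K); tauto.
Qed.

(** The body of an input is left unconstrained because no output comes from under a prefix.
    Restrictions are compared by swaps rather than substitutions: swaps are invertible and compose,
    as symmetry and transitivity of [alpha] require. *)
Definition alpha_shape (p q : proc) : Prop :=
  match p, q with
  | Nil, Nil => True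
  | Out a b, Out c d => a = c /\ b = d
  | Inp _ _ _, Inp _ _ _ => True
  | Res a p, Res b q => alpha q (act (swap a b) p)
  | Par p q, Par p' q' => alpha p p' /\ alpha q q'
  | Rep p, Rep q => alpha p q
  | _, _ => False
  end.

Lemma alpha_inv p q : alpha p q -> alpha_shape p q.
Proof.
  induction 1 as [p|p q H IH|p q r H1 IH1 H2 IH2|x y y' p Hn|y y' p Hn| | | | |]; simpl.
  - destruct p; simpl; auto using al_refl.
    rewrite act_id; [apply al_refl | intros x; swp].
  - destruct p, q; simpl in *; try tauto; try (intuition (congruence || auto using al_sym)).
    apply al_sym in IH.
    apply (alpha_act (swap n0 n)) in IH; [|apply swap_inj].
    rewrite act_comp, act_id in IH; [exact IH | intros x; swp].
  - destruct p, q, r; simpl in *; try tauto.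
    + intuition congruence.
    + eapply al_trans; [exact IH2|].
      eapply al_trans; [apply (alpha_act (swap n0 n1)), IH1; apply swap_inj|].
      (* The two swaps through [n0] agree with the direct one on the free names of the body, because
         neither [n0] nor [n1] is free in the first restriction. *)
      rewrite act_comp; apply act_agree_alpha; auto using swap_inj, inj_comp.
      intros x Hx.
      assert (Ha : x <> n -> x <> n0).
      { intros Hxn E; subst.
        assert (K : free_in n0 (Res n p)) by (simpl; auto).
        apply (free_alpha _ _ _ H1) in K; simpl in K; tauto. }
      assert (Hb : x <> n -> x <> n1).
      { intros Hxn E; subst.
        assert (K : free_in n1 (Res n p)) by (simpl; auto).
        apply (free_alpha _ _ _ H1), (free_alpha _ _ _ H2) in K; simpl in K; tauto. }
      destruct (name_eq_dec x n) as [->|Hxn].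
      * rewrite !swap_l; reflexivity.
      * rewrite (swap_other n n0), (swap_other n0 n1), (swap_other n n1); auto.
    + intuition (eauto using alpha).
    + eauto using alpha.
  - exact I.
  - apply subst_alpha_swap; exact Hn.
  - exact I.
  - rewrite act_id; [apply al_sym; auto | intros x; swp].
  - auto using al_refl.
  - auto using al_refl.
  - assumption.
Qed.

Lemma alpha_res_inv a b p q : alpha (Res a p) (Res b q) ->
  ~ free_in b (Res a p) /\ alpha q (act (swap a b) p).
Proof.
  intros H; split; [|exact (alpha_inv _ _ H)].
  rewrite (free_alpha _ _ _ H); simpl; tauto.
Qed.

(** * Equivariance and free names of the transition system *)

Lemma sc_refl p : scong p p.
Proof. apply sc_alpha, al_refl. Qed.

Lemma scong_act f p q : inj f -> scong p q -> scong (act f p) (act f q).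
Proof.
  intros Hf; induction 1; simpl; eauto using scong.
  - apply sc_alpha, alpha_act; auto.
  - apply sc_extr; rewrite free_act; auto.
Qed.

Lemma free_scong p q x : scong p q -> free_in x p <-> free_in x q.
Proof.
  induction 1 as [p q H|p q H IH|p q r H1 IH1 H2 IH2|p q|p q r|a p q Hn| | | | |]; simpl; try tauto.
  - apply free_alpha, H.
  - destruct (name_eq_dec x a); subst; tauto.
Qed.

Lemma trans_act f p l q : inj f -> trans p l q -> trans (act f p) (lact f l) (act f q).
Proof.
  intros Hf; induction 1 as [x y|x y z p Hb|x y p p' Ht IH Hn|y p mu p' Ht IH Hn
    |p q mu p' Ht IH Hn|p q x y p' q' H1 IH1 H2 IH2|p q x y p' q' H1 IH1 H2 IH2 Hn
    |p mu p' Ht IH|p q mu q' p' Hs Ht IH Hs']; simpl in *.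
  - apply t_out.
  - rewrite subst_act by auto; apply t_in; rewrite bound_act; auto.
  - apply t_open; auto.
  - apply t_res; auto; rewrite lab_names_lact, in_map_inj; auto.
  - apply t_par; auto; intros b; rewrite lab_bn_lact, in_map_iff.
    intros [c [<- Hc]]; rewrite free_act; auto.
  - eapply t_com; eauto.
  - eapply t_close; eauto; rewrite free_act; auto.
  - apply t_rep; auto.
  - eapply t_cong; eauto using scong_act.
Qed.

Lemma free_subst z y p x : free_in x (subst z y p) -> x = z \/ (x <> y /\ free_in x p).
Proof.
  assert (R : forall a, (x = if name_eq_dec a y then z else a) <->
     (a = y /\ x = z) \/ (a <> y /\ x = a)) by (intros a; destruct name_eq_dec; intuition).
  induction p as [|a b|a b p IH|a p IH|p IHp q IHq|p IH]; simpl; rewrite ?R.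
  - tauto.
  - intuition (subst; tauto).
  - destruct (name_eq_dec b y); subst; intuition (subst; tauto).
  - destruct (name_eq_dec a y); subst; intuition (subst; tauto).
  - tauto.
  - tauto.
Qed.

(** Non-freeness of an extruded name holds at [t_open] and survives parallel contexts by the side
    condition of [t_par]; it is what makes the name exchangeable for another one. *)
Lemma trans_out_names p l q : trans p l q ->
  match l with
  | LOut x y => free_in x p /\ free_in y p
  | LBOut x y => free_in x p /\ ~ free_in y p /\ x <> y
  | _ => True
  end.
Proof.
  induction 1 as [x y|x y z p Hb|x y p p' Ht IH Hn|y p mu p' Ht IH Hn
    |p q mu p' Ht IH Hn|p q x y p' q' H1 IH1 H2 IH2|p q x y p' q' H1 IH1 H2 IH2 Hn
    |p mu p' Ht IH|p q mu q' p' Hs Ht IH Hs']; simpl in *; try tauto.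
  - destruct mu as [| |x z|x z]; simpl in *; try tauto; intuition (subst; tauto || congruence).
  - destruct mu as [| |x z|x z]; simpl in *; try tauto.
    specialize (Hn z (or_introl eq_refl)); tauto.
  - destruct mu; simpl in *; tauto.
  - destruct mu; rewrite ?(free_scong _ _ _ Hs); exact IH.
Qed.

Lemma trans_free p l q x : trans p l q -> free_in x q -> free_in x p \/ In x (lab_names l).
Proof.
  induction 1 as [a y|a y z p Hb|a y p p' Ht IH Hn|y p mu p' Ht IH Hn
    |p q mu p' Ht IH Hn|p q a y p' q' H1 IH1 H2 IH2|p q a y p' q' H1 IH1 H2 IH2 Hn
    |p mu p' Ht IH|p q mu q' p' Hs Ht IH Hs']; simpl in *; intros H; try tauto.
  - apply free_subst in H; intuition auto.
  - destruct (name_eq_dec x y) as [->|]; tauto.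
  - pose proof (trans_out_names _ _ _ H1) as Ho; simpl in Ho.
    intuition (subst; tauto).
  - pose proof (trans_out_names _ _ _ H1) as Ho; simpl in Ho.
    intuition (subst; tauto).
  - rewrite <- (free_scong _ _ x Hs') in H; rewrite (free_scong _ _ x Hs); auto.
Qed.

(** * Output transitions without structural congruence *)

Definition bn_fresh (l : label) (q : proc) : Prop :=
  forall b, In b (lab_bn l) -> ~ free_in b q.

(* The output transitions, described by recursion on the process: structural
   congruence is replaced by alpha-conversion at the restrictions crossed, so
   that derivations can be inverted. *)
Inductive emit : label -> proc -> proc -> Prop :=
| em_out x y : emit (LOut x y) (Out x y) Nil
| em_open a p x c p1 p' : alpha (Res a p) (Res c p1) ->
    emit (LOut x c) p1 p' -> x <> c -> emit (LBOut x c) (Res a p) p'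
| em_res l a p c p1 p' : alpha (Res a p) (Res c p1) -> ~ In c (lab_names l) ->
    emit l p1 p' -> emit l (Res a p) (Res c p')
| em_parl l p q p' : emit l p p' -> bn_fresh l q -> emit l (Par p q) (Par p' q)
| em_parr l p q q' : emit l q q' -> bn_fresh l p -> emit l (Par p q) (Par p q')
| em_rep0 l p p' : emit l p p' -> bn_fresh l p -> emit l (Rep p) (Par p' (Rep p))
| em_rep1 l p r : emit l (Rep p) r -> bn_fresh l p -> emit l (Rep p) (Par p r).

Lemma bn_fresh_act f l q : inj f -> bn_fresh l q -> bn_fresh (lact f l) (act f q).
Proof.
  intros Hf H b; rewrite lab_bn_lact, in_map_iff.
  intros [c [<- Hc]]; rewrite free_act; auto.
Qed.

Lemma bn_fresh_incl l p q :
  (forall x, free_in x q -> free_in x p) -> bn_fresh l p -> bn_fresh l q.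
Proof. intros H Hp b Hb Hq; exact (Hp b Hb (H b Hq)). Qed.

Lemma bn_fresh_scong l p q : scong p q -> bn_fresh l p -> bn_fresh l q.
Proof. intros H; apply bn_fresh_incl; intros x; apply (free_scong _ _ x H). Qed.

Lemma emit_trans l p q : emit l p q -> trans p l q.
Proof.
  induction 1 as [x y|a p x c p1 p' Ha He IH Hn|l a p c p1 p' Ha Hn He IH
    |l p q p' He IH Hf|l p q q' He IH Hf|l p p' He IH Hf|l p r He IH Hf].
  - apply t_out.
  - eapply t_cong; [apply sc_alpha, Ha | apply t_open; eauto | apply sc_refl].
  - eapply t_cong; [apply sc_alpha, Ha | apply t_res; eauto | apply sc_refl].
  - apply t_par; auto.
  - eapply t_cong; [apply sc_comm | apply t_par; eauto | apply sc_comm].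
  - apply t_rep, t_par; auto.
  - apply t_rep; eapply t_cong; [apply sc_comm | apply t_par; eauto | apply sc_comm].
Qed.

Lemma emit_act f l p q : inj f -> emit l p q -> emit (lact f l) (act f p) (act f q).
Proof.
  intros Hf; induction 1 as [x y|a p x c p1 p' Ha He IH Hn|l a p c p1 p' Ha Hn He IH
    |l p q p' He IH Hb|l p q q' He IH Hb|l p p' He IH Hb|l p r He IH Hb]; simpl in *.
  - apply em_out.
  - eapply em_open; eauto. apply (alpha_act f _ _ Hf Ha).
  - eapply em_res; eauto; [apply (alpha_act f _ _ Hf Ha)|].
    rewrite lab_names_lact, in_map_inj; auto.
  - apply em_parl; auto using bn_fresh_act.
  - apply em_parr; auto using bn_fresh_act.
  - apply em_rep0; auto using bn_fresh_act.
  - apply em_rep1; auto using bn_fresh_act.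
Qed.

(** The restriction rules already contain an alpha step, so transitivity of [alpha] settles them
    with the same residual. *)
Lemma emit_alpha l p q : emit l p q -> forall p2, alpha p p2 ->
  exists q2, emit l p2 q2 /\ alpha q q2.
Proof.
  induction 1 as [x y|a p x c p1 p' Ha He IH Hn|l a p c p1 p' Ha Hn He IH
    |l p q p' He IH Hb|l p q q' He IH Hb|l p p' He IH Hb|l p r He IH Hb];
    intros p2 H2; pose proof (alpha_inv _ _ H2) as Hs; destruct p2; simpl in Hs; try tauto.
  - destruct Hs as [<- <-]; eauto using emit, al_refl.
  - exists p'; split; [|apply al_refl].
    eapply em_open; eauto; eapply al_trans; [apply al_sym|]; eauto.
  - exists (Res c p'); split; [|apply al_refl].
    eapply em_res; eauto; eapply al_trans; [apply al_sym|]; eauto.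
  - destruct Hs as [Hs1 Hs2]; destruct (IH _ Hs1) as [q2 [Hq Hq2]].
    exists (Par q2 p2_2); split; [|apply alpha_par; auto].
    apply em_parl; auto; eapply bn_fresh_scong; [apply sc_alpha|]; eauto.
  - destruct Hs as [Hs1 Hs2]; destruct (IH _ Hs2) as [q2 [Hq Hq2]].
    exists (Par p2_1 q2); split; [|apply alpha_par; auto].
    apply em_parr; auto; eapply bn_fresh_scong; [apply sc_alpha|]; eauto.
  - destruct (IH _ Hs) as [q2 [Hq Hq2]].
    exists (Par q2 (Rep p2)); split; [|apply alpha_par; auto].
    apply em_rep0; auto; eapply bn_fresh_scong; [apply sc_alpha|]; eauto.
  - destruct (IH _ H2) as [q2 [Hq Hq2]].
    exists (Par p2 q2); split; [|apply alpha_par; auto].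
    apply em_rep1; auto; eapply bn_fresh_scong; [apply sc_alpha|]; eauto.
Qed.

Lemma emit_res l a d p p' : ~ free_in d (Res a p) -> ~ In d (lab_names l) ->
  emit l (act (swap a d) p) p' -> emit l (Res a p) (Res d p').
Proof. intros Hd Hl He; eapply em_res; eauto using res_swap_alpha. Qed.

Lemma emit_open x a y p p' : ~ free_in y (Res a p) -> x <> y ->
  emit (LOut x y) (act (swap a y) p) p' -> emit (LBOut x y) (Res a p) p'.
Proof. intros Hd Hl He; eapply em_open; eauto using res_swap_alpha. Qed.

(** The binder chosen inside the derivation is unknown; equivariance trades it for any [d] fresh for
    the process and the label. When the restriction is opened, the label dictates the name
    instead. *)
Lemma emit_res_inv l a p r d : emit l (Res a p) r ->
  ~ free_in d (Res a p) -> ~ In d (lab_names l) ->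
  (exists p', emit l (act (swap a d) p) p' /\ alpha r (Res d p')) \/
  (exists x y p', l = LBOut x y /\ x <> y /\ ~ free_in y (Res a p) /\
     emit (LOut x y) (act (swap a y) p) p' /\ alpha r p').
Proof.
  intros H Hd Hl; inversion H as [|a0 p0 x c p1 p' Ha He Hn|l0 a0 p0 c p1 p' Ha Hn He| | | |];
    subst; destruct (alpha_res_inv _ _ _ _ Ha) as [Hc Hp].
  - right; destruct (emit_alpha _ _ _ He _ Hp) as [q2 [Hq Hq2]].
    exists x, c, q2; auto.
  - left; destruct (emit_alpha _ _ _ He _ Hp) as [q2 [Hq Hq2]].
    pose proof (emit_act (swap c d) _ _ _ (swap_inj c d) Hq) as H1.
    rewrite lact_swap_fresh in H1 by auto.
    assert (A : alpha (act (swap c d) (act (swap a c) p)) (act (swap a d) p)).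
    { rewrite act_comp; apply act_agree_alpha; auto using swap_inj, inj_comp.
      intros x Hx; destruct (name_eq_dec x a) as [->|Hxa]; [rewrite !swap_l; reflexivity|].
      assert (x <> c) by (intros ->; apply Hc; simpl; auto).
      assert (x <> d) by (intros ->; apply Hd; simpl; auto).
      rewrite (swap_other a c x), (swap_other c d x), (swap_other a d x); auto. }
    destruct (emit_alpha _ _ _ H1 _ A) as [q3 [Hq3 Hq4]].
    exists q3; split; auto.
    eapply al_trans; [apply al_cres, Hq2|].
    eapply al_trans; [apply (res_swap_alpha _ d)|apply al_cres, Hq4].
    simpl; intros [Hdc Hf].
    apply (trans_free _ _ _ _ (emit_trans _ _ _ Hq)) in Hf as [Hf|Hf]; [|auto].
    rewrite free_swap in Hf; simpl in Hd, Hc.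
    destruct (name_eq_dec d a) as [->|Hda].
    + rewrite swap_l in Hf; apply Hc; auto.
    + rewrite swap_other in Hf by auto; apply Hd; auto.
Qed.

(** * Structural congruence preserves output transitions *)

Definition simulates (p q : proc) : Prop :=
  forall l r, emit l p r -> exists r', emit l q r' /\ scong r r'.

Lemma simulates_comm p q : simulates (Par p q) (Par q p).
Proof.
  intros l r H; inversion H; subst; eexists; (split; [|apply sc_comm]);
    eauto using emit.
Qed.

Lemma bn_fresh_par l p q : bn_fresh l (Par p q) <-> bn_fresh l p /\ bn_fresh l q.
Proof. unfold bn_fresh; simpl; firstorder. Qed.

Lemma simulates_assoc p q s : simulates (Par (Par p q) s) (Par p (Par q s)).
Proof.
  intros l r H; inversion H as [| | |? ? ? ? He Hb|? ? ? ? He Hb| |]; subst.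
  - inversion He as [| | |? ? ? ? He' Hb'|? ? ? ? He' Hb'| |]; subst;
      eexists; (split; [|apply sc_assoc]).
    + apply em_parl; auto; rewrite bn_fresh_par; auto.
    + apply em_parr; auto using em_parl.
  - rewrite bn_fresh_par in Hb; eexists; (split; [|apply sc_assoc]).
    apply em_parr; [apply em_parr|]; tauto.
Qed.

Lemma simulates_assoc_sym p q s : simulates (Par p (Par q s)) (Par (Par p q) s).
Proof.
  intros l r H; inversion H as [| | |? ? ? ? He Hb|? ? ? ? He Hb| |]; subst.
  - rewrite bn_fresh_par in Hb; eexists; (split; [|apply sc_sym, sc_assoc]).
    apply em_parl; [apply em_parl|]; tauto.
  - inversion He as [| | |? ? ? ? He' Hb'|? ? ? ? He' Hb'| |]; subst;
      eexists; (split; [|apply sc_sym, sc_assoc]).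
    + apply em_parl; auto using em_parr.
    + apply em_parr; auto; rewrite bn_fresh_par; auto.
Qed.

(** The congruence hypothesis serves when [q] moves: [p] then remains in the residual, and its free
    names enter the freshness condition. *)
Lemma simulates_parl p p' q : simulates p p' -> scong p p' -> simulates (Par p q) (Par p' q).
Proof.
  intros S E l r H; inversion H as [| | |? ? ? ? He Hb|? ? ? ? He Hb| |]; subst.
  - destruct (S _ _ He) as [r' [Hr Hs]]; exists (Par r' q); split;
      [apply em_parl; auto | apply sc_cparl; auto].
  - exists (Par p' q'); split; [|apply sc_cparl; auto].
    apply em_parr; eauto using bn_fresh_scong.
Qed.

Lemma simulates_parr p q q' : simulates q q' -> scong q q' -> simulates (Par p q) (Par p q').
Proof.
  intros S E l r H; inversion H as [| | |? ? ? ? He Hb|? ? ? q'' He Hb| |]; subst.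
  - exists (Par p' q'); split; [|apply sc_cparr; auto].
    apply em_parl; eauto using bn_fresh_scong.
  - destruct (S _ _ He) as [r' [Hr Hs]]; exists (Par p r'); split;
      [apply em_parr; auto | apply sc_cparr; auto].
Qed.

(** By induction on the derivation, because [em_rep1] emits again from the same replication: the
    syntax does not bound the number of unfolded copies. *)
Lemma simulates_rep p q : simulates p q -> scong p q -> simulates (Rep p) (Rep q).
Proof.
  intros S E l r H; remember (Rep p) as s eqn:Es.
  induction H as [| | | | |l p0 p' He IH Hb|l p0 r He IH Hb]; try discriminate;
    injection Es as ->.
  - destruct (S _ _ He) as [r' [Hr Hs]]; exists (Par r' (Rep q)); split.
    + apply em_rep0; eauto using bn_fresh_scong.
    + eapply sc_trans; [apply sc_cparl, Hs | apply sc_cparr, sc_crep, E].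
  - destruct (IH eq_refl) as [r' [Hr Hs]]; exists (Par q r'); split.
    + apply em_rep1; eauto using bn_fresh_scong.
    + eapply sc_trans; [apply sc_cparl, E | apply sc_cparr, Hs].
Qed.

(** Inverting a restriction yields an emission of the swapped body, while simulation is known for
    the original one; equivariance bridges the two. *)
Lemma simulates_swap a b p q :
  simulates p q -> simulates (act (swap a b) p) (act (swap a b) q).
Proof.
  intros S l r H; apply (emit_act (swap a b)) in H; [|apply swap_inj].
  rewrite act_swap_invol in H; destruct (S _ _ H) as [r' [Hr Hs]].
  exists (act (swap a b) r'); split.
  - apply (emit_act (swap a b)) in Hr; [|apply swap_inj].
    rewrite lact_swap_invol in Hr; exact Hr.
  - apply (scong_act (swap a b)) in Hs; [|apply swap_inj].
    rewrite act_swap_invol in Hs; exact Hs.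
Qed.

Lemma simulates_res a p q : simulates p q -> scong p q -> simulates (Res a p) (Res a q).
Proof.
  intros S E l r H.
  assert (F : forall x, free_in x (Res a q) <-> free_in x (Res a p))
    by (intros x; symmetry; apply free_scong, sc_cres, E).
  destruct (exists_fresh (nms (Res a p) ++ lab_names l)) as [d Hd].
  rewrite in_app_iff in Hd.
  assert (Hdp : ~ free_in d (Res a p)) by (intros K; apply free_nms in K; tauto).
  assert (Hdl : ~ In d (lab_names l)) by tauto.
  destruct (emit_res_inv _ _ _ _ d H Hdp Hdl)
    as [[p' [He Ha]]|[x [y [p' [-> [Hxy [Hy [He Ha]]]]]]]].
  - destruct (simulates_swap a d _ _ S _ _ He) as [r' [Hr Hs]].
    exists (Res d r'); split.
    + apply emit_res; auto; rewrite F; auto.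
    + eapply sc_trans; [apply sc_alpha, Ha | apply sc_cres, Hs].
  - destruct (simulates_swap a y _ _ S _ _ He) as [r' [Hr Hs]].
    exists r'; split.
    + eapply emit_open; eauto; rewrite F; auto.
    + eapply sc_trans; [apply sc_alpha, Ha | apply Hs].
Qed.

(* The restricted name has to be renamed away from [q] before extruding. *)
Lemma simulates_extr a p q : ~ free_in a q -> simulates (Par (Res a p) q) (Res a (Par p q)).
Proof.
  intros Hq l r H.
  assert (Q : forall d, ~ free_in d q -> alpha q (act (swap a d) q))
    by (intros d Hd; apply al_sym, swap_fresh_alpha; auto).
  destruct (exists_fresh (nms (Par (Res a p) q) ++ lab_names l)) as [d Hd].
  rewrite in_app_iff in Hd.
  assert (Hdpq : ~ free_in d (Par (Res a p) q)) by (intros K; apply free_nms in K; tauto).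
  assert (Hdp : ~ free_in d (Res a p)) by (simpl in *; tauto).
  assert (Hdq : ~ free_in d q) by (simpl in *; tauto).
  assert (Hdl : ~ In d (lab_names l)) by tauto.
  assert (Hdr : ~ free_in d (Res a (Par p q))) by (simpl in *; tauto).
  inversion H as [| | |? ? ? ? He Hb|? ? ? q' He Hb| |]; subst.
  - destruct (emit_res_inv _ _ _ _ d He Hdp Hdl)
      as [[p'' [He' Ha]]|[x [y [p'' [-> [Hxy [Hy [He' Ha]]]]]]]].
    + destruct (emit_alpha _ _ _ (em_parl _ _ _ _ He' Hb)
        (Par (act (swap a d) p) (act (swap a d) q))) as [r [Hr Hs]].
      { apply al_cparr, Q, Hdq. }
      exists (Res d r); split; [apply emit_res; auto|].
      eapply sc_trans; [apply sc_cparl, sc_alpha, Ha|].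
      eapply sc_trans; [apply sc_extr, Hdq | apply sc_cres, sc_alpha, Hs].
    + assert (Hyq : ~ free_in y q) by (apply Hb; simpl; auto).
      assert (Hb' : bn_fresh (LOut x y) q) by (intros b []).
      destruct (emit_alpha _ _ _ (em_parl _ _ _ _ He' Hb')
        (Par (act (swap a y) p) (act (swap a y) q))) as [r [Hr Hs]].
      { apply al_cparr, Q, Hyq. }
      exists r; split; [apply emit_open; auto; simpl in *; tauto|].
      eapply sc_trans; [apply sc_cparl, sc_alpha, Ha | apply sc_alpha, Hs].
  - assert (Hb' : bn_fresh l (act (swap a d) p)).
    { intros b Hbl K; rewrite free_swap in K; apply (Hb b Hbl); simpl.
      assert (b <> d) by (intros ->; apply Hdl, lab_bn_names, Hbl).
      destruct (name_eq_dec b a) as [->|Hba].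
      - rewrite swap_l in K; exfalso; apply Hdp; simpl; auto.
      - rewrite swap_other in K by auto; tauto. }
    destruct (emit_alpha _ _ _ (em_parr _ _ _ _ He Hb')
        (Par (act (swap a d) p) (act (swap a d) q))) as [r [Hr Hs]].
    { apply al_cparr, Q, Hdq. }
    exists (Res d r); split; [apply emit_res; auto|].
    eapply sc_trans; [apply sc_cparl, sc_alpha, (res_swap_alpha a d), Hdp|].
    eapply sc_trans; [apply sc_extr|apply sc_cres, sc_alpha, Hs].
    intros K; apply (trans_free _ _ _ _ (emit_trans _ _ _ He)) in K; tauto.
Qed.

Lemma simulates_extr_sym a p q : ~ free_in a q -> simulates (Res a (Par p q)) (Par (Res a p) q).
Proof.
  intros Hq l r H.
  assert (Q : forall d, ~ free_in d q -> alpha q (act (swap a d) q))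
    by (intros d Hd; apply al_sym, swap_fresh_alpha; auto).
  destruct (exists_fresh (nms (Par (Res a p) q) ++ lab_names l)) as [d Hd].
  rewrite in_app_iff in Hd.
  assert (Hdpq : ~ free_in d (Par (Res a p) q)) by (intros K; apply free_nms in K; tauto).
  assert (Hdp : ~ free_in d (Res a p)) by (simpl in *; tauto).
  assert (Hdq : ~ free_in d q) by (simpl in *; tauto).
  assert (Hdl : ~ In d (lab_names l)) by tauto.
  assert (Hdr : ~ free_in d (Res a (Par p q))) by (simpl in *; tauto).
  destruct (emit_res_inv _ _ _ _ d H Hdr Hdl)
      as [[s [He Ha]]|[x [y [s [-> [Hxy [Hy [He Ha]]]]]]]]; simpl in He.
  - destruct (emit_alpha _ _ _ He (Par (act (swap a d) p) q)) as [s' [He' Ha']].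
    { apply al_cparr, al_sym, Q, Hdq. }
    inversion He' as [| | |? ? ? p'' He'' Hb|? ? ? q'' He'' Hb| |]; subst.
    + exists (Par (Res d p'') q); split.
      * apply em_parl; auto using emit_res.
      * eapply sc_trans; [apply sc_alpha, Ha|].
        eapply sc_trans; [apply sc_cres, sc_alpha, Ha'|apply sc_sym, sc_extr, Hdq].
    + exists (Par (Res a p) q''); split.
      * apply em_parr; auto; intros b Hbl K; apply (Hb b Hbl); simpl in K.
        rewrite free_swap, swap_other; try tauto.
        intros ->; apply Hdl, lab_bn_names, Hbl.
      * eapply sc_trans; [apply sc_alpha, Ha|].
        eapply sc_trans; [apply sc_cres, sc_alpha, Ha'|].
        eapply sc_trans; [apply sc_sym, sc_extr|].
        -- intros K; apply (trans_free _ _ _ _ (emit_trans _ _ _ He'')) in K; tauto.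
        -- apply sc_cparl, sc_alpha, al_sym, res_swap_alpha, Hdp.
  - assert (Hyq : ~ free_in y q).
    { destruct (name_eq_dec y a) as [->|]; [exact Hq | simpl in Hy; tauto]. }
    destruct (emit_alpha _ _ _ He (Par (act (swap a y) p) q)) as [s' [He' Ha']].
    { apply al_cparr, al_sym, Q, Hyq. }
    inversion He' as [| | |? ? ? p'' He'' Hb|? ? ? q'' He'' Hb| |]; subst.
    + exists (Par p'' q); split.
      * apply em_parl; [apply emit_open; auto; simpl in *; tauto|].
        intros b [<-|[]]; exact Hyq.
      * eapply sc_trans; [apply sc_alpha, Ha | apply sc_alpha, Ha'].
    (* If [q] emitted [y], then [y] would be free in [q]: the extruded name can only come from
       [p]. *)
    + exfalso; apply Hyq, (trans_out_names _ _ _ (emit_trans _ _ _ He'')).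
Qed.

(** Both directions go together because [scong] is closed under symmetry. Congruence below an input
    is vacuous: an input emits nothing. *)
Lemma scong_simulates p q : scong p q -> simulates p q /\ simulates q p.
Proof.
  induction 1 as [p q H|p q H IH|p q r H1 IH1 H2 IH2|p q|p q r|a p q Hn
    |x y p q H IH|y p q H IH|p p' q H IH|p q q' H IH|p q H IH].
  - split; intros l r He; [|apply al_sym in H];
      destruct (emit_alpha _ _ _ He _ H) as [r' []]; exists r'; auto using sc_alpha.
  - tauto.
  - split; intros l s He.
    + destruct (proj1 IH1 _ _ He) as [s1 [He1 Hs1]].
      destruct (proj1 IH2 _ _ He1) as [s2 [He2 Hs2]]; eauto using sc_trans.
    + destruct (proj2 IH2 _ _ He) as [s1 [He1 Hs1]].
      destruct (proj2 IH1 _ _ He1) as [s2 [He2 Hs2]]; eauto using sc_trans.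
  - auto using simulates_comm.
  - auto using simulates_assoc, simulates_assoc_sym.
  - auto using simulates_extr, simulates_extr_sym.
  - split; intros l r He; inversion He.
  - split; apply simulates_res; try tauto; auto using sc_sym.
  - split; apply simulates_parl; try tauto; auto using sc_sym.
  - split; apply simulates_parr; try tauto; auto using sc_sym.
  - split; apply simulates_rep; try tauto; auto using sc_sym.
Qed.

Definition is_output (l : label) : Prop :=
  match l with LOut _ _ | LBOut _ _ => True | _ => False end.

Lemma emit_is_output l p q : emit l p q -> is_output l.
Proof. induction 1; simpl; auto. Qed.

(** Every use of [t_cong] is pushed into the residual by [scong_simulates]; this is what makes
    output transitions invertible. *)
Lemma trans_emit p l q : trans p l q -> is_output l -> exists q', emit l p q' /\ scong q' q.
Proof.
  induction 1 as [x y|x y z p Hb|x y p p' Ht IH Hn|y p mu p' Ht IH Hn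
    |p q mu p' Ht IH Hn|p q x y p' q' H1 IH1 H2 IH2|p q x y p' q' H1 IH1 H2 IH2 Hn
    |p mu p' Ht IH|p q mu q' p' Hs Ht IH Hs']; intros Ho; try (simpl in Ho; tauto).
  - eauto using emit, sc_refl.
  - destruct (IH I) as [q' [He Hs]]; exists q'; split; auto.
    eapply em_open; eauto using al_refl.
  - destruct (IH Ho) as [q' [He Hs]]; exists (Res y q'); split; [|apply sc_cres, Hs].
    eapply em_res; eauto using al_refl.
  - destruct (IH Ho) as [q' [He Hs]]; exists (Par q' q); split; [|apply sc_cparl, Hs].
    apply em_parl; auto.
  - destruct (IH Ho) as [q' [He Hs]]; exists q'; split; auto.
    inversion He; subst; [apply em_rep0 | apply em_rep1]; assumption.
  - destruct (IH Ho) as [q'' [He Hs'']].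
    destruct (proj2 (scong_simulates _ _ Hs) _ _ He) as [r [Hr Hrs]].
    exists r; split; auto.
    eapply sc_trans; [apply sc_sym, Hrs|].
    eapply sc_trans; [exact Hs''|exact Hs'].
Qed.

(** * Commutation of an input with an output *)

Lemma emit_refresh x y y' p q : emit (LBOut x y) p q -> ~ free_in y' p ->
  exists q', emit (LBOut x y') p q' /\ alpha (act (swap y y') q) q'.
Proof.
  intros He Hy'.
  destruct (trans_out_names _ _ _ (emit_trans _ _ _ He)) as [Hx [Hy Hxy]].
  pose proof (emit_act (swap y y') _ _ _ (swap_inj y y') He) as H; simpl in H.
  rewrite swap_l, swap_other in H by (auto; intros ->; auto).
  exact (emit_alpha _ _ _ H _ (swap_fresh_alpha y y' p Hy Hy')).
Qed.

(* In the asynchronous calculus an output is not a prefix, hence it commutes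
   with the inputs of the same process. *)
Lemma input_emit_diamond p m q2 : trans p m q2 ->
  forall z v, m = LIn z v -> forall l q1, emit l p q1 ->
  (forall b, In b (lab_bn l) -> b <> z /\ b <> v) ->
  exists s, trans q1 m s /\ trans q2 l s.
Proof.
  induction 1 as [x y|x y u p Hb|x y p p' Ht IH Hn|a p mu p' Ht IH Hn
    |p q mu p' Ht IH Hn|p q x y p' q' H1 IH1 H2 IH2|p q x y p' q' H1 IH1 H2 IH2 Hn
    |p mu p' Ht IH|p q mu q' p' Hs Ht IH Hs'];
    intros z v Em l q1 He Hbn; try discriminate Em.
  (* An input prefix emits nothing, so the input and the output never compete for the same
     prefix. *)
  - inversion He.
  - subst mu.
    assert (Haz : a <> z /\ a <> v) by (simpl in Hn; split; intros ->; tauto).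
    specialize (IH z v eq_refl).
    assert (Main : forall l q1, emit l (Res a p) q1 ->
      (forall b, In b (lab_bn l) -> b <> z /\ b <> v) -> ~ In a (lab_bn l) ->
      exists s, trans q1 (LIn z v) s /\ trans (Res a p') l s).
    { clear l q1 He Hbn; intros l q1 He Hbn Hal.
      assert (Ha : ~ In a (lab_names l)).
      { pose proof (trans_out_names _ _ _ (emit_trans _ _ _ He)) as Ho.
        pose proof (emit_is_output _ _ _ He).
        destruct l; simpl in *; intuition congruence. }
      assert (Hfa : ~ free_in a (Res a p)) by (simpl; tauto).
      destruct (emit_res_inv _ _ _ _ a He Hfa Ha)
        as [[r [Hr Hra]]|[x [y [r [-> [Hxy [Hy [Hr Hra]]]]]]]].
      - rewrite act_id in Hr by (intros; swp).
        destruct (IH _ _ Hr Hbn) as [s [Hs1 Hs2]]; exists (Res a s); split.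
        + eapply t_cong; [apply sc_alpha, Hra | apply t_res; eauto | apply sc_refl].
        + apply t_res; auto.
      - assert (Hyz : y <> z /\ y <> v) by (apply Hbn; simpl; auto).
        assert (Hya : y <> a) by (simpl in Ha; intuition).
        assert (Hxa : x <> a) by (simpl in Ha; intuition).
        (* Swapping back turns the extruded [y] into the binder [a], so that the induction
           hypothesis applies to [p] itself. *)
        apply (emit_act (swap a y)) in Hr; [|apply swap_inj].
        simpl in Hr; rewrite act_swap_invol, swap_r, swap_other in Hr by auto.
        destruct (IH _ _ Hr) as [s [Hs1 Hs2]]; [intros b []|].
        exists (act (swap a y) s); split.
        + apply (trans_act (swap a y)) in Hs1; [|apply swap_inj].
          simpl in Hs1; rewrite act_swap_invol, !swap_other in Hs1 by (intuition congruence).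
          eapply t_cong; [apply sc_alpha, Hra | exact Hs1 | apply sc_refl].
        + apply (trans_act (swap a y)) in Hs2; [|apply swap_inj].
          simpl in Hs2; rewrite swap_l, swap_other in Hs2 by auto.
          eapply t_cong; [apply sc_alpha, res_swap_alpha | apply t_open; eauto | apply sc_refl].
          simpl; intros [_ K]; apply (trans_free _ _ _ _ Ht) in K; simpl in *.
          intuition congruence. }
    destruct (classic (In a (lab_bn l))) as [Ha|Ha]; [|auto].
    destruct l as [| | |x y]; simpl in Ha; try tauto.
    destruct Ha as [->|[]].
    (* The extruded name clashes with [a]: extrude a fresh one and rename back. *)
    destruct (exists_fresh (a :: z :: v :: nms (Res a p))) as [y' Hy'].
    assert (Hfr : ~ free_in y' (Res a p))
      by (intros K; apply Hy'; do 3 right; apply free_nms, K).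
    destruct (emit_refresh _ _ y' _ _ He Hfr) as [q' [He' Ha']].
    assert (Hne : y' <> a /\ y' <> z /\ y' <> v) by (simpl in Hy'; intuition congruence).
    destruct (Main _ _ He') as [s [Hs1 Hs2]].
    { simpl; intros b [<-|[]]; tauto. }
    { simpl; tauto. }
    destruct (trans_out_names _ _ _ (emit_trans _ _ _ He)) as [Hx [Hy Hxy]].
    exists (act (swap a y') s); split.
    + apply (trans_act (swap a y')) in Hs1; [|apply swap_inj].
      simpl in Hs1; rewrite !swap_other in Hs1 by (intuition congruence).
      eapply t_cong; [|exact Hs1|apply sc_refl].
      rewrite <- (act_swap_invol a y' q1) at 1.
      apply sc_alpha, alpha_act; auto using swap_inj.
    + apply (trans_act (swap a y')) in Hs2; [|apply swap_inj].
      assert (x <> y') by (intros ->; auto).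
      simpl in Hs2; rewrite swap_l, swap_r, swap_other in Hs2 by auto.
      eapply t_cong; [|exact Hs2|apply sc_refl].
      apply sc_alpha, res_swap_alpha; simpl; intros [_ K].
      apply (trans_free _ _ _ _ Ht) in K; simpl in *; intuition congruence.
  - specialize (IH z v Em).
    inversion He as [| | |? ? ? r He' Hb|? ? ? r He' Hb| |]; subst.
    + destruct (IH _ _ He' Hbn) as [s [Hs1 Hs2]]; exists (Par s q); split; apply t_par; auto.
    + exists (Par p' r); split; [apply t_par; auto; intros b []|].
      apply emit_trans, em_parr; auto.
      intros b Hbl K; apply (trans_free _ _ _ _ Ht) in K as [K|K]; [exact (Hb b Hbl K)|].
      apply Hbn in Hbl; simpl in K; intuition congruence.
  (* The rules of [emit] for a replication are those of its one-step unfolding, which is the source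
     of the premise of [t_rep]. *)
  - apply (IH z v Em); auto.
    inversion He; subst; [apply em_parl | apply em_parr]; assumption.
  - destruct (proj1 (scong_simulates _ _ Hs) _ _ He) as [r [Hr Hrs]].
    destruct (IH z v Em _ _ Hr Hbn) as [s [Hs1 Hs2]]; exists s; split.
    + eapply t_cong; eauto using sc_refl.
    + eapply t_cong; [apply sc_sym, Hs'|exact Hs2|apply sc_refl].
Qed.

Lemma input_output_diamond p z v q2 l q1 :
  trans p (LIn z v) q2 -> trans p l q1 -> is_output l ->
  (forall b, In b (lab_bn l) -> b <> z /\ b <> v) ->
  exists s, trans q1 (LIn z v) s /\ trans q2 l s.
Proof.
  intros Hi Ht Ho Hb; destruct (trans_emit _ _ _ Ht Ho) as [q' [He Hs]].
  destruct (input_emit_diamond _ _ _ Hi z v eq_refl _ _ He Hb) as [s [Hs1 Hs2]].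
  exists s; split; auto.
  eapply t_cong; [apply sc_sym, Hs|exact Hs1|apply sc_refl].
Qed.

Lemma trans_bound_output_refresh x y y' p q : trans p (LBOut x y) q -> ~ free_in y' p ->
  trans p (LBOut x y') (act (swap y y') q).
Proof.
  intros Ht Hy'; destruct (trans_out_names _ _ _ Ht) as [Hx [Hy Hxy]].
  apply (trans_act (swap y y')) in Ht; [|apply swap_inj].
  simpl in Ht; rewrite swap_l, swap_other in Ht by (auto; intros ->; auto).
  eapply t_cong; [apply sc_alpha, al_sym, swap_fresh_alpha | exact Ht | apply sc_refl]; auto.
Qed.

(** The process cannot tell apart two received names that are both absent from it: swapping them
    leaves it unchanged up to alpha. *)
Lemma trans_input_refresh x y y' p q : trans p (LIn x y) q ->
  x <> y -> x <> y' -> ~ free_in y p -> ~ free_in y' p ->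
  trans p (LIn x y') (act (swap y y') q).
Proof.
  intros Ht Hxy Hxy' Hy Hy'; apply (trans_act (swap y y')) in Ht; [|apply swap_inj].
  simpl in Ht; rewrite swap_l, swap_other in Ht by auto.
  eapply t_cong; [apply sc_alpha, al_sym, swap_fresh_alpha | exact Ht | apply sc_refl]; auto.
Qed.

(** * Symmetric rounds *)

(** All that the rounds use of sigma and of its extension to names. The last field asks for an
    entire orbit outside [F], of full length [k], because in one round the [k] components may
    extrude [k] different names. *)
Record cyclic_symmetry (k : nat) (sN : nat -> nat) (pi : name -> name) : Prop := {
  cs_ge2 : 2 <= k;
  cs_node : forall i, node k i -> node k (sN i);
  cs_period : forall i, node k i -> Nat.iter k sN i = i;
  cs_distinct : forall i a b, node k i -> a < k -> b < k ->
    Nat.iter a sN i = Nat.iter b sN i -> a = b;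
  cs_orbit : forall i j, node k i -> node k j -> exists a, a < k /\ Nat.iter a sN i = j;
  cs_pi_period : forall x, Nat.iter k pi x = x;
  cs_pi_o : pi NO = NO;
  cs_pi_node : forall i, node k i -> pi (NNat i) = NNat (sN i);
  cs_pi_fresh : forall F : list name, exists w,
    (forall a, ~ In (Nat.iter a pi w) F) /\
    (forall a b, a < k -> b < k -> Nat.iter a pi w = Nat.iter b pi w -> a = b)
}.

Lemma iter_node k sN pi a i : cyclic_symmetry k sN pi -> node k i -> node k (Nat.iter a sN i).
Proof. intros H Hi; induction a; simpl; auto; apply (cs_node _ _ _ H); auto. Qed.

Lemma iter_inj f a : inj f -> inj (Nat.iter a f).
Proof. intros H; induction a; simpl; intros x y E; auto. Qed.

Lemma iter_period_inj k f : 0 < k -> (forall x, Nat.iter k f x = x) -> inj f.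
Proof.
  intros Hk H x y E; destruct k as [|k]; [lia|].
  rewrite <- (H x), <- (H y), !Nat.iter_succ_r, E; reflexivity.
Qed.

Lemma pi_inj k sN pi : cyclic_symmetry k sN pi -> inj pi.
Proof.
  intros H; pose proof (cs_ge2 _ _ _ H).
  apply (iter_period_inj k); [lia | apply (cs_pi_period _ _ _ H)].
Qed.

(** Iterates take natural exponents, so the inverse of the [b]-th iterate is written as the iterate
    of exponent [k - b]. *)
Lemma iter_pi_solve k sN pi a b w u : cyclic_symmetry k sN pi -> b <= k ->
  Nat.iter a pi w = Nat.iter b pi u -> u = Nat.iter (k - b + a) pi w.
Proof.
  intros H Hb E; rewrite Nat.iter_add, E, <- Nat.iter_add.
  replace (k - b + b) with k by lia; symmetry; apply (cs_pi_period _ _ _ H).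
Qed.

Definition invariant (k : nat) (sN : nat -> nat) (pi : name -> name) (s : nstate) : Prop :=
  (forall x, In x (nres s) -> In (pi x) (nres s)) /\
  (forall i, node k i -> scong (ncomp s (sN i)) (act pi (ncomp s i))).

Lemma invariant_iter k sN pi rs c a i : cyclic_symmetry k sN pi ->
  invariant k sN pi (NS rs c) -> node k i ->
  scong (c (Nat.iter a sN i)) (act (Nat.iter a pi) (c i)).
Proof.
  intros H [_ Hc] Hi; simpl in Hc; induction a as [|a IH]; simpl.
  - rewrite act_id by reflexivity; apply sc_refl.
  - eapply sc_trans; [apply Hc, (iter_node _ _ _ _ _ H Hi)|].
    apply (scong_act pi) in IH; [|apply (pi_inj _ _ _ H)].
    rewrite act_comp in IH; exact IH.
Qed.

Lemma invariant_trans k sN pi rs c a i l q : cyclic_symmetry k sN pi ->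
  invariant k sN pi (NS rs c) -> node k i -> trans (c i) l q ->
  trans (c (Nat.iter a sN i)) (lact (Nat.iter a pi) l) (act (Nat.iter a pi) q).
Proof.
  intros H Hs Hi Ht; eapply t_cong; [eapply invariant_iter; eauto| |apply sc_refl].
  apply trans_act; auto; apply iter_inj, (pi_inj _ _ _ H).
Qed.

(** Being closed under [pi], the restricted names are also closed under its inverse: completing the
    cycle takes [k - a] further steps forward. *)
Lemma invariant_res_iter k sN pi rs c a x : cyclic_symmetry k sN pi ->
  invariant k sN pi (NS rs c) -> a <= k -> In (Nat.iter a pi x) rs -> In x rs.
Proof.
  intros H [Hr _] Ha Hx; simpl in Hr.
  rewrite <- (cs_pi_period _ _ _ H x).
  replace k with (k - a + a) by lia; rewrite Nat.iter_add.
  induction (k - a) as [|n IH]; simpl; auto.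
Qed.

(** * Runs and their announcements *)

Definition nsteps : Type := list (label * contrib * nstate).

Inductive run (k : nat) (s : nstate) : nsteps -> nstate -> Prop :=
| run_nil : run k s [] s
| run_snoc L t mu K u : run k s L t -> nstep k t mu K u -> run k s (L ++ [(mu, K, u)]) u.

Lemma run_app k s L t L' u : run k s L t -> run k t L' u -> run k s (L ++ L') u.
Proof.
  intros H; induction 1 as [|L' t' mu K u Hr IH Hs].
  - rewrite app_nil_r; exact H.
  - rewrite app_assoc; apply run_snoc with t'; auto.
Qed.

Definition announced (L : nsteps) (v : name) : Prop :=
  exists mu K u i p p', In (mu, K, u) L /\ K i = Some (p, LOut NO v, p').

Lemma announced_app L L' v : announced (L ++ L') v <-> announced L v \/ announced L' v.
Proof.
  unfold announced; split.
  - intros [mu [K [u [i [p [p' [H E]]]]]]]; rewrite in_app_iff in H.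
    destruct H; [left|right]; exists mu, K, u, i, p, p'; auto.
  - intros [H|H]; destruct H as [mu [K [u [i [p [p' [H E]]]]]]];
      exists mu, K, u, i, p, p'; rewrite in_app_iff; auto.
Qed.

Lemma announced_one mu K u v :
  announced [(mu, K, u)] v <-> exists i p p', K i = Some (p, LOut NO v, p').
Proof.
  unfold announced; split.
  - intros [mu' [K' [u' [i [p [p' [[E|[]] H]]]]]]]; injection E as <- <- <-; eauto.
  - intros [i [p [p' H]]]; exists mu, K, u, i, p, p'; simpl; auto.
Qed.

Lemma announced_one_contrib mu u i p l p' v :
  announced [(mu, one_contrib i (p, l, p'), u)] v <-> l = LOut NO v.
Proof.
  rewrite announced_one; unfold one_contrib; split.
  - intros [j [q [q' H]]]; destruct Nat.eq_dec; congruence.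
  - intros ->; exists i, p, p'; destruct Nat.eq_dec; congruence.
Qed.

Lemma announced_two_contrib mu u i p l p' j q x y q' v :
  announced [(mu, two_contrib i (p, l, p') j (q, LIn x y, q'), u)] v <-> l = LOut NO v.
Proof.
  rewrite announced_one; unfold two_contrib; split.
  - intros [h [r [r' H]]]; repeat destruct Nat.eq_dec; congruence.
  - intros ->; exists i, p, p'; destruct Nat.eq_dec; congruence.
Qed.

Definition announcement_closed (pi : name -> name) (L : nsteps) : Prop :=
  forall v, announced L v -> announced L (pi v).

Lemma orbit_announcement_closed k sN pi L l : cyclic_symmetry k sN pi ->
  (forall v, announced L v <-> exists b, b < k /\ lact (Nat.iter b pi) l = LOut NO v) ->
  announcement_closed pi L.
Proof.
  intros H HL v; rewrite !HL; intros [b [Hb E]].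
  destruct l as [| |x y|]; try discriminate E; injection E as Ex Ey.
  assert (E' : lact (Nat.iter (S b) pi) (LOut x y) = LOut NO (pi v)).
  { simpl; rewrite Ex, Ey, (cs_pi_o _ _ _ H); reflexivity. }
  destruct (Nat.eq_dec (S b) k) as [Ek|].
  - exists 0; split; [lia|].
    simpl in E' |- *; rewrite <- E'.
    change (pi (Nat.iter b pi x)) with (Nat.iter (S b) pi x).
    change (pi (Nat.iter b pi y)) with (Nat.iter (S b) pi y).
    rewrite Ek, !(cs_pi_period _ _ _ H); reflexivity.
  - exists (S b); split; [lia | exact E'].
Qed.

Lemma orbit_invariant k sN pi rs c i q : cyclic_symmetry k sN pi -> node k i ->
  (forall x, In x rs -> In (pi x) rs) ->
  (forall b, b < k -> c (Nat.iter b sN i) = act (Nat.iter b pi) q) ->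
  invariant k sN pi (NS rs c).
Proof.
  intros H Hi Hr Hc; split; simpl; auto; intros j Hj.
  destruct (cs_orbit _ _ _ H i j Hi Hj) as [b [Hb <-]].
  rewrite (Hc b Hb), act_comp.
  (* The last component of the orbit is followed by the first one; there the periods of [sN] and
     [pi] close the cycle. *)
  destruct (Nat.eq_dec (S b) k) as [Ek|].
  - change (sN (Nat.iter b sN i)) with (Nat.iter (S b) sN i).
    rewrite Ek, (cs_period _ _ _ H i Hi).
    pose proof (Hc 0 ltac:(lia)) as H0; simpl in H0; rewrite H0, !act_id; try reflexivity.
    + apply sc_refl.
    + intros x; change (pi (Nat.iter b pi x)) with (Nat.iter (S b) pi x).
      rewrite Ek; apply (cs_pi_period _ _ _ H).
  - change (sN (Nat.iter b sN i)) with (Nat.iter (S b) sN i).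
    rewrite (Hc (S b)) by lia; apply sc_refl.
Qed.

Definition network_fresh (k : nat) (rs : list name) (c : nat -> proc) (x : name) : Prop :=
  ~ In x rs /\ forall j, node k j -> ~ free_in x (c j).

Definition fresh_orbit (k : nat) (pi : name -> name) (rs : list name) (c : nat -> proc)
  (w : name) : Prop :=
  (forall a, network_fresh k rs c (Nat.iter a pi w)) /\
  (forall a b, a < k -> b < k -> Nat.iter a pi w = Nat.iter b pi w -> a = b).

Lemma exists_fresh_orbit k sN pi rs c : cyclic_symmetry k sN pi ->
  exists w, fresh_orbit k pi rs c w.
Proof.
  intros H.
  destruct (cs_pi_fresh _ _ _ H (rs ++ flat_map (fun j => nms (c j)) (seq 1 k)))
    as [w [Hw Hd]].
  exists w; split; auto; intros a; specialize (Hw a); rewrite in_app_iff, in_flat_map in Hw.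
  split; [tauto|]; intros j Hj K; apply Hw; right; exists j; split.
  - apply in_seq; unfold node in Hj; lia.
  - apply free_nms, K.
Qed.

(** * Replaying one step around the orbit *)

Lemma upd_same c i p : upd c i p i = p.
Proof. unfold upd; destruct Nat.eq_dec; congruence. Qed.

Lemma upd_other c i p j : j <> i -> upd c i p j = c j.
Proof. unfold upd; destruct Nat.eq_dec; congruence. Qed.

(** Each component moves exactly once, so the one at position [a] is still in its initial state when
    its turn comes. If a name is extruded, its images along the orbit are new and pairwise distinct,
    so no component that has already moved contains the next one. *)
Lemma round_par k sN pi rs c i l q : cyclic_symmetry k sN pi ->
  invariant k sN pi (NS rs c) -> node k i -> trans (c i) l q ->
  (forall x, In x (lab_names l) -> ~ In x rs) ->
  (forall b, In b (lab_bn l) -> fresh_orbit k pi rs c b) ->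
  exists L u, run k (NS rs c) L u /\ invariant k sN pi u /\ L <> [] /\
    announcement_closed pi L.
Proof.
  intros H Hs Hi Ht Hrs Hbn.
  assert (Main : forall a, a <= k -> exists L c', run k (NS rs c) L (NS rs c') /\
    length L = a /\
    (forall b, b < k -> c' (Nat.iter b sN i) =
       if b <? a then act (Nat.iter b pi) q else c (Nat.iter b sN i)) /\
    (forall v, announced L v <-> exists b, b < a /\ lact (Nat.iter b pi) l = LOut NO v)).
  { induction a as [|a IH]; intros Ha.
    - exists [], c; repeat split; auto using run_nil.
      + intros [? [? [? [? [? [? [[] _]]]]]]].
      + intros [b [Hb _]]; lia.
    - destruct IH as [L [c' [HL [Hlen [Hc' Han]]]]]; [lia|].
      assert (Hia : node k (Nat.iter a sN i)) by (eapply iter_node; eauto).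
      assert (Hta : trans (c' (Nat.iter a sN i)) (lact (Nat.iter a pi) l) (act (Nat.iter a pi) q)).
      { rewrite Hc', Nat.ltb_irrefl by lia; eapply invariant_trans; eauto. }
      eexists; eexists; split; [|split; [|split]].
      + eapply run_snoc; [exact HL|]; apply ns_par; [exact Hia|exact Hta| |].
        * rewrite lab_names_lact; intros x Hx Hxr.
          apply in_map_iff in Hx as [y [<- Hy]]; apply (Hrs y Hy).
          eapply invariant_res_iter with (a := a); eauto; lia.
        * rewrite lab_bn_lact; intros x Hx j Hj Hja K.
          apply in_map_iff in Hx as [w [<- Hw]]; destruct (Hbn w Hw) as [Hfr Hdist].
          destruct (cs_orbit _ _ _ H i j Hi Hj) as [b [Hb <-]].
          rewrite Hc' in K by auto; destruct (b <? a).
          -- apply free_act_preimage in K as [u [E Hu]].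
             (* [u] lies on the fresh orbit of [w]; it can thus only be the extruded name itself,
                and then [a = b]. *)
             assert (Hui : ~ free_in u (c i)).
             { apply (iter_pi_solve _ _ _ a b w u H) in E; [subst u|lia].
               apply Hfr; auto. }
             destruct (trans_free _ _ _ _ Ht Hu) as [|Hul]; [auto|].
             destruct l as [| | |x y]; simpl in Hw; try tauto.
             destruct Hw as [->|[]]; destruct Hul as [<-|[<-|[]]].
             ++ apply Hui, (trans_out_names _ _ _ Ht).
             ++ apply Hdist in E; [congruence|lia|lia].
          -- apply (Hfr a) in K; auto.
      + rewrite length_app; simpl; lia.
      + intros b Hb; destruct (Nat.eq_dec b a) as [->|Hba].
        * rewrite upd_same; destruct (Nat.ltb_spec a (S a)); [reflexivity|lia].
        * rewrite upd_other, Hc' by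
            (auto; intros E; apply (cs_distinct _ _ _ H) in E; auto; lia).
          destruct (Nat.ltb_spec b a), (Nat.ltb_spec b (S a)); try reflexivity; lia.
      + intros v; rewrite announced_app, Han, announced_one_contrib; split.
        * intros [[b [Hb E]]|E]; [exists b|exists a]; auto.
        * intros [b [Hb E]]; destruct (Nat.eq_dec b a) as [->|]; [right; auto|].
          left; exists b; split; [lia|auto]. }
  destruct (Main k (le_n k)) as [L [c' [HL [Hlen [Hc' Han]]]]].
  pose proof (cs_ge2 _ _ _ H).
  exists L, (NS rs c'); split; [|split; [|split]]; auto.
  - eapply orbit_invariant with (i := i) (q := q); eauto; [apply Hs|].
    intros b Hb; rewrite Hc' by auto; destruct (Nat.ltb_spec b k); [reflexivity|lia].
  - intros ->; simpl in Hlen; lia.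
  - eapply orbit_announcement_closed; eauto.
Qed.

(* State of the [b]-th component of the orbit during a round of communications,
   according to whether it has already sent and already received; the diamond
   property makes the final state independent of the order. *)
Definition cell (p q1 q2 s : proc) (f : name -> name) (sent received : bool) : proc :=
  match sent, received with
  | false, false => p
  | true, false => act f q1
  | false, true => act f q2
  | true, true => act f s
  end.

(** The component at position [a] of the orbit sends to position [a + d] modulo [k]; hence position
    [b] receives at step [sender k d b]. Conditionals in place of [mod] leave only linear goals. *)
Definition sender (k d b : nat) : nat := if d <=? b then b - d else b + k - d.

Definition receiver (k d a : nat) : nat := if a + d <? k then a + d else a + d - k.

Ltac nat_bool := unfold sender, receiver in *; repeat
  match goal with
  | |- context [?x <=? ?y] => destruct (Nat.leb_spec x y)
  | |- context [?x <? ?y] => destruct (Nat.ltb_spec x y)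
  | H : context [?x <=? ?y] |- _ => destruct (Nat.leb_spec x y)
  | H : context [?x <? ?y] |- _ => destruct (Nat.ltb_spec x y)
  end; try reflexivity; try lia.

Lemma iter_receiver (A : Type) k d a (f : A -> A) (x : A) : Nat.iter k f x = x ->
  d < k -> a < k -> Nat.iter (receiver k d a) f x = Nat.iter (a + d) f x.
Proof.
  intros H Hd Ha; unfold receiver; destruct (Nat.ltb_spec (a + d) k); auto.
  rewrite <- H at 1; rewrite <- Nat.iter_add; f_equal; lia.
Qed.

(** The [k] pairs at distance [d] communicate in turn, so every component sends once and receives
    once, in an order that depends on its position. The receiver's input is pulled back by [d]
    positions to [c i], so that both actions belong to one process and the diamond applies; hence
    the iterates in the output label. *)
Lemma round_com k sN pi rs c i d l q1 z v q2 : cyclic_symmetry k sN pi ->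
  invariant k sN pi (NS rs c) -> node k i -> 0 < d < k ->
  trans (c i) l q1 -> trans (c i) (LIn z v) q2 ->
  (l = LOut (Nat.iter d pi z) (Nat.iter d pi v) \/
   l = LBOut (Nat.iter d pi z) (Nat.iter d pi v) /\ fresh_orbit k pi rs c (Nat.iter d pi v)) ->
  exists L u, run k (NS rs c) L u /\ invariant k sN pi u /\ L <> [] /\
    announcement_closed pi L.
Proof.
  intros H Hs Hi Hd Ht1 Ht2 Hl.
  set (x := Nat.iter d pi z) in *; set (y := Nat.iter d pi v) in *.
  assert (Hx : free_in x (c i)).
  { pose proof (trans_out_names _ _ _ Ht1) as Ho; destruct Hl as [->|[-> _]]; tauto. }
  (* [x] is free in [c i], so its orbit cannot meet the fresh orbit of [y]. *)
  assert (Hfr : forall a b, b <= k -> In y (lab_bn l) -> Nat.iter a pi y = Nat.iter b pi x -> False).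
  { intros a b Hb Hy E; destruct Hl as [->|[-> [Hf _]]]; [destruct Hy|].
    apply (iter_pi_solve _ _ _ a b y x H Hb) in E; rewrite E in Hx; exact (proj2 (Hf _) i Hi Hx). }
  destruct (input_output_diamond _ _ _ _ _ _ Ht2 Ht1) as [s [Hs1 Hs2]].
  { destruct Hl as [->|[-> _]]; exact I. }
  (* The diamond requires the extruded [y] to differ from [z] and [v]: [y = z] would put [x] on the
     orbit of [y], and [y = v] would give that orbit the period [d < k]. *)
  { intros b Hb; assert (Hby : b = y).
    { destruct Hl as [->|[-> _]]; simpl in Hb; [tauto|intuition]. }
    subst b; split; intros E.
    - apply (Hfr d 0); auto; [lia|]; simpl; unfold x; rewrite <- E; reflexivity.
    - destruct Hl as [->|[-> [_ Hdist]]]; [destruct Hb|].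
      assert (E' : Nat.iter d pi y = Nat.iter 0 pi y) by (simpl; rewrite E at 1; reflexivity).
      apply Hdist in E'; lia. }
  set (st := fun a b => cell (c (Nat.iter b sN i)) q1 q2 s (Nat.iter b pi)
                          (b <? a) (sender k d b <? a)).
  assert (Hsend : forall b r, trans
    (cell (c (Nat.iter b sN i)) q1 q2 s (Nat.iter b pi) false r) (lact (Nat.iter b pi) l)
    (cell (c (Nat.iter b sN i)) q1 q2 s (Nat.iter b pi) true r)).
  { intros b [|]; simpl; [|eapply invariant_trans; eauto].
    apply trans_act; auto; apply iter_inj, (pi_inj _ _ _ H). }
  assert (Hrecv : forall b r, trans
    (cell (c (Nat.iter b sN i)) q1 q2 s (Nat.iter b pi) r false) (lact (Nat.iter b pi) (LIn z v))
    (cell (c (Nat.iter b sN i)) q1 q2 s (Nat.iter b pi) r true)).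
  { intros b [|]; simpl cell; [|eapply invariant_trans; eauto].
    apply trans_act; auto; apply iter_inj, (pi_inj _ _ _ H). }
  (* [ns_close] demands freshness in components halfway through the round; their additional names
     come from the labels they have already performed. *)
  assert (Hcf : forall b sn rc u,
    free_in u (cell (c (Nat.iter b sN i)) q1 q2 s (Nat.iter b pi) sn rc) ->
    free_in u (c (Nat.iter b sN i)) \/ exists u0, u = Nat.iter b pi u0 /\
      (free_in u0 (c i) \/ (sn = true /\ In u0 (lab_names l)) \/ (rc = true /\ In u0 [z; v]))).
  { intros b [|] [|] u K; simpl in K; auto; right;
      apply free_act_preimage in K as [u0 [-> K]]; exists u0; split; auto.
    - apply (trans_free _ _ _ _ Hs1) in K as [K|K]; [|simpl in *; tauto].
      apply (trans_free _ _ _ _ Ht1) in K; tauto.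
    - apply (trans_free _ _ _ _ Ht1) in K; tauto.
    - apply (trans_free _ _ _ _ Ht2) in K; simpl in *; tauto. }
  assert (Main : forall a, a <= k -> exists L c' rs', run k (NS rs c) L (NS rs' c') /\
    length L = a /\
    (forall b, b < k -> c' (Nat.iter b sN i) = st a b) /\
    (forall v, announced L v <-> exists b, b < a /\ lact (Nat.iter b pi) l = LOut NO v) /\
    (forall u, In u rs' <-> In u rs \/ exists b, b < a /\ In u (map (Nat.iter b pi) (lab_bn l)))).
  { induction a as [|a IH]; intros Ha.
    - exists [], c, rs; split; [apply run_nil|]; repeat split; auto.
      + intros [? [? [? [? [? [? [[] _]]]]]]].
      + intros [b [Hb _]]; lia.
      + intros [|[b [Hb _]]]; [auto|lia].
    - destruct IH as [L [c' [rs' [HL [Hlen [Hc' [Han Hrs']]]]]]]; [lia|].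
      assert (Hr : receiver k d a < k /\ receiver k d a <> a) by nat_bool.
      assert (Hia : node k (Nat.iter a sN i)) by (eapply iter_node; eauto).
      assert (Hir : node k (Nat.iter (receiver k d a) sN i)) by (eapply iter_node; eauto).
      assert (Hne : Nat.iter a sN i <> Nat.iter (receiver k d a) sN i).
      { intros E; apply (cs_distinct _ _ _ H) in E; auto; lia. }
      assert (Hta : trans (c' (Nat.iter a sN i)) (lact (Nat.iter a pi) l) (st (S a) a)).
      { rewrite Hc' by lia; unfold st.
        replace (a <? a) with false by nat_bool; replace (a <? S a) with true by nat_bool.
        (* As [0 < d < k], position [a] does not receive at the step where it sends. *)
        replace (sender k d a <? S a) with (sender k d a <? a) by nat_bool.
        apply Hsend. }
      assert (Htr : trans (c' (Nat.iter (receiver k d a) sN i))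
         (LIn (Nat.iter a pi x) (Nat.iter a pi y)) (st (S a) (receiver k d a))).
      { rewrite Hc' by lia; unfold st.
        replace (sender k d (receiver k d a)) with a by nat_bool.
        replace (a <? a) with false by nat_bool; replace (a <? S a) with true by nat_bool.
        replace (receiver k d a <? S a) with (receiver k d a <? a) by nat_bool.
        (* The two labels match: the [a]-th image of [x] is the image of [z] with exponent [a + d],
           which modulo [k] is the receiver's position; likewise for [y] and [v]. *)
        unfold x, y; rewrite <- !Nat.iter_add.
        rewrite <- !(iter_receiver _ k d a pi) by (lia || apply (cs_pi_period _ _ _ H)).
        apply Hrecv. }
      set (c'' := upd (upd c' (Nat.iter a sN i) (st (S a) a))
                    (Nat.iter (receiver k d a) sN i) (st (S a) (receiver k d a))).
      assert (Hc'' : forall b, b < k -> c'' (Nat.iter b sN i) = st (S a) b).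
      { intros b Hb; unfold c''; destruct (Nat.eq_dec b (receiver k d a)) as [->|Hbr].
        - apply upd_same.
        - rewrite upd_other by (intros E; apply (cs_distinct _ _ _ H) in E; auto; lia).
          destruct (Nat.eq_dec b a) as [->|Hba]; [apply upd_same|].
          rewrite upd_other, Hc' by
            (auto; intros E; apply (cs_distinct _ _ _ H) in E; auto; lia).
          unfold st; replace (b <? S a) with (b <? a) by nat_bool.
          replace (sender k d b <? S a) with (sender k d b <? a) by nat_bool.
          reflexivity. }
      assert (Hann : forall Q : nat -> Prop,
        (exists b, b < a /\ Q b) \/ Q a <-> exists b, b < S a /\ Q b).
      { intros Q; split.
        - intros [[b [Hb E]]|E]; [exists b|exists a]; auto.
        - intros [b [Hb E]]; destruct (Nat.eq_dec b a) as [->|]; [right; auto|].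
          left; exists b; split; [lia|auto]. }
      destruct Hl as [El|[El [Hnf Hdist]]].
      + eexists; exists c'', rs'; split; [|split; [|split; [|split]]]; [| |exact Hc''| |].
        * eapply run_snoc; [exact HL|].
          rewrite El in Hta; eapply ns_com; [exact Hia|exact Hir|exact Hne|exact Hta|exact Htr].
        * rewrite length_app; simpl; lia.
        * intros v0; rewrite announced_app, Han, announced_two_contrib.
          rewrite <- Hann; rewrite El; reflexivity.
        * intros u; rewrite Hrs', El; simpl; split; (intros [|[b [_ []]]]; auto).
      + eexists; exists c'', (Nat.iter a pi y :: rs');
          split; [|split; [|split; [|split]]]; [| |exact Hc''| |].
        * eapply run_snoc; [exact HL|].
          rewrite El in Hta; eapply ns_close; [exact Hia|exact Hir|exact Hne|exact Hta|exact Htr| |].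
          -- rewrite Hrs'; intros [K|[b [Hb K]]]; [exact (proj1 (Hnf a) K)|].
             rewrite El in K; destruct K as [K|[]]; apply Hdist in K; lia.
          -- intros j Hj Hja K.
             destruct (cs_orbit _ _ _ H i j Hi Hj) as [b [Hb <-]].
             assert (Hba : b <> a) by (intros ->; auto).
             rewrite Hc' in K by auto; apply Hcf in K as [K|[u [E K]]].
             { exact (proj2 (Hnf a) _ Hj K). }
             assert (Hyl : In y (lab_bn l)) by (rewrite El; simpl; auto).
             destruct K as [K|[[_ K]|[Er K]]].
             ++ apply (iter_pi_solve _ _ _ a b y u H) in E; [|lia].
                rewrite E in K; exact (proj2 (Hnf _) i Hi K).
             ++ rewrite El in K; destruct K as [<-|[<-|[]]].
                ** apply (Hfr a b); auto; lia.
                ** apply Hdist in E; [congruence|lia|lia].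
             (* A name received at position [b] is the [b]-th image of [z] or [v]; [d] further
                iterations express it through [x] or [y]. *)
             ++ apply (f_equal (Nat.iter d pi)) in E; rewrite <- !Nat.iter_add in E.
                rewrite (Nat.add_comm d b), (Nat.iter_add b d) in E.
                destruct K as [<-|[<-|[]]].
                ** apply (Hfr (d + a) b); auto; lia.
                (* Here [b] turns out to be the receiver of step [a], which cannot have received
                   before. *)
                ** fold y in E; rewrite (Nat.add_comm d a) in E.
                   rewrite <- (iter_receiver _ k d a pi) in E
                     by (lia || apply (cs_pi_period _ _ _ H)).
                   apply Hdist in E; [|lia|lia]; subst b; apply Nat.ltb_lt in Er; nat_bool.
        * rewrite length_app; simpl; lia.
        * intros v0; rewrite announced_app, Han, announced_two_contrib.
          rewrite <- Hann; rewrite El; reflexivity.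
        * intros u; rewrite <- (Hann (fun b => In u (map (Nat.iter b pi) (lab_bn l)))).
          simpl; rewrite Hrs', El; simpl; tauto. }
  destruct (Main k (le_n k)) as [L [c' [rs' [HL [Hlen [Hc' [Han Hrs']]]]]]].
  exists L, (NS rs' c'); split; [|split; [|split]]; auto.
  - eapply orbit_invariant with (i := i) (q := s); eauto.
    + intros u; rewrite !Hrs'; intros [Hu|[b [Hb Hu]]]; [left; apply Hs, Hu|right].
      apply in_map_iff in Hu as [w [<- Hw]].
      change (pi (Nat.iter b pi w)) with (Nat.iter (S b) pi w).
      destruct (Nat.eq_dec (S b) k) as [Ek|].
      * exists 0; split; [lia|]; rewrite Ek, (cs_pi_period _ _ _ H).
        apply (in_map (Nat.iter 0 pi)) in Hw; exact Hw.
      * exists (S b); split; [lia|]; apply in_map, Hw.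
    + intros b Hb; rewrite Hc' by auto; unfold st.
      replace (b <? k) with true by nat_bool.
      replace (sender k d b <? k) with true by nat_bool; reflexivity.
  - intros ->; simpl in Hlen; lia.
  - eapply orbit_announcement_closed; eauto.
Qed.

Lemma round k sN pi s mu K t : cyclic_symmetry k sN pi ->
  invariant k sN pi s -> nstep k s mu K t ->
  exists L u, run k s L u /\ invariant k sN pi u /\ L <> [] /\ announcement_closed pi L.
Proof.
  intros H Hs Hst.
  assert (Hoff : forall i j, node k i -> node k j -> i <> j ->
     exists d, 0 < d < k /\ Nat.iter d sN i = j).
  { intros i j Hi Hj Hij; destruct (cs_orbit _ _ _ H i j Hi Hj) as [d [Hd E]].
    exists d; split; auto; destruct d; [simpl in E; congruence|lia]. }
  (* The receiver's input is carried from [j] to [i] by completing the orbit, [k - d] steps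
     forward. *)
  assert (Hback : forall rs c i j d x y q, invariant k sN pi (NS rs c) -> node k i -> node k j ->
     0 < d < k -> Nat.iter d sN i = j -> trans (c j) (LIn x y) q ->
     exists z v q2, trans (c i) (LIn z v) q2 /\ x = Nat.iter d pi z /\ y = Nat.iter d pi v).
  { intros rs c i j d x y q Hinv Hi Hj Hd <- Ht.
    exists (Nat.iter (k - d) pi x), (Nat.iter (k - d) pi y), (act (Nat.iter (k - d) pi) q).
    apply (invariant_trans k sN pi rs c (k - d)) in Ht; auto.
    rewrite <- !Nat.iter_add in *.
    replace (k - d + d) with k in Ht by lia; replace (d + (k - d)) with k by lia.
    rewrite (cs_period _ _ _ H i Hi) in Ht; rewrite !(cs_pi_period _ _ _ H); auto. }
  destruct Hst as [rs c i mu p' Hi Ht Hrs Hbn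
    |rs c i j x y pi' pj' Hi Hj Hij Hti Htj
    |rs c i j x y pi' pj' Hi Hj Hij Hti Htj Hyr Hyf].
  - destruct mu as [|x y|x y|x y]; try (eapply round_par; eauto; intros b []; fail).
    destruct (exists_fresh_orbit k sN pi rs c H) as [w Hw].
    pose proof (proj1 Hw 0) as [Hwr Hwf]; simpl in Hwr, Hwf.
    eapply round_par with (l := LBOut x w); eauto.
    + apply trans_bound_output_refresh with (y := y); [exact Ht | exact (Hwf i Hi)].
    + simpl; intros u [<-|[<-|[]]]; auto; apply Hrs; simpl; auto.
    + simpl; intros b [<-|[]]; exact Hw.
  - destruct (Hoff i j Hi Hj Hij) as [d [Hd Ed]].
    destruct (Hback _ _ _ _ _ _ _ _ Hs Hi Hj Hd Ed Htj) as [z [v [q2 [Ht2 [-> ->]]]]].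
    eapply (round_com _ _ _ _ _ _ _ _ _ _ _ _ H Hs Hi Hd Hti Ht2); auto.
  - destruct (Hoff i j Hi Hj Hij) as [d [Hd Ed]].
    destruct (exists_fresh_orbit k sN pi rs c H) as [w Hw].
    pose proof (proj1 Hw 0) as [Hwr Hwf]; simpl in Hwr, Hwf.
    destruct (trans_out_names _ _ _ Hti) as [Hxi [Hyi Hxy]].
    assert (Hxw : x <> w) by (intros ->; apply (Hwf i Hi), Hxi).
    apply (trans_bound_output_refresh _ _ w) in Hti; [|exact (Hwf i Hi)].
    (* The receiver has to take in the replacement name as well; the side condition of [ns_close]
       keeps [y] from being free in it. *)
    apply (trans_input_refresh _ _ w) in Htj; [|auto|auto|apply Hyf; auto|exact (Hwf j Hj)].
    destruct (Hback _ _ _ _ _ _ _ _ Hs Hi Hj Hd Ed Htj) as [z [v [q2 [Ht2 [-> Ew]]]]].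
    rewrite Ew in *.
    eapply (round_com _ _ _ _ _ _ _ _ _ _ _ _ H Hs Hi Hd Hti Ht2); auto.
Qed.

(** * The symmetry as a permutation of all names *)

Definition remv (b : name) : list name -> list name :=
  filter (fun x => if name_eq_dec x b then false else true).

(** An ordered list with repetitions rather than a set: a renaming that maps the list to itself
    fixes every entry, whereas it could permute the elements of a set. *)
Fixpoint free_occs (p : proc) : list name :=
  match p with
  | Nil => []
  | Out a b => [a; b]
  | Inp a b q => a :: remv b (free_occs q)
  | Res a q => remv a (free_occs q)
  | Par p q => free_occs p ++ free_occs q
  | Rep q => free_occs q
  end.

Lemma in_remv x b L : In x (remv b L) <-> x <> b /\ In x L.
Proof.
  unfold remv; rewrite filter_In; destruct name_eq_dec; intuition congruence.
Qed.

Lemma in_free_occs x p : In x (free_occs p) <-> free_in x p.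
Proof.
  induction p; simpl; rewrite ?in_app_iff, ?in_remv; intuition congruence.
Qed.

Lemma remv_map f b c L : (forall x, In x L -> f x = c <-> x = b) ->
  remv c (map f L) = map f (remv b L).
Proof.
  induction L as [|x L IH]; simpl; intros H; auto.
  specialize (IH (fun y Hy => H y (or_intror Hy))); specialize (H x (or_introl eq_refl)).
  unfold remv in *; simpl.
  destruct (name_eq_dec (f x) c), (name_eq_dec x b); simpl; try tauto.
  f_equal; exact IH.
Qed.

(** Injectivity is asked only at the bound names, because the lemma takes part in proving that the
    renaming is injective. *)
Lemma free_occs_act f p : (forall b, bound_in b p -> forall x, f x = f b -> x = b) ->
  free_occs (act f p) = map f (free_occs p).
Proof.
  induction p as [|a b|a b p IH|a p IH|p IHp q IHq|p IH]; simpl; intros H; auto.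
  - rewrite IH by auto; rewrite (remv_map f b); auto.
    intros x _; split; [apply H; auto | congruence].
  - rewrite IH by auto; rewrite (remv_map f a); auto.
    intros x _; split; [apply H; auto | congruence].
  - rewrite map_app, IHp, IHq; auto.
Qed.

Lemma free_occs_subst c y p : ~ occurs c p ->
  free_occs (subst c y p) = map (fun x => if name_eq_dec x y then c else x) (free_occs p).
Proof.
  set (r := fun x => if name_eq_dec x y then c else x).
  assert (R : forall L, remv y L = map r (remv y L)).
  { intros L; rewrite <- map_id at 1; apply map_ext_in; intros x Hx.
    apply in_remv in Hx; unfold r; destruct name_eq_dec; tauto. }
  assert (S : forall b L, b <> y -> b <> c -> remv b (map r L) = map r (remv b L)).
  { intros b L Hy Hc; apply remv_map; intros x _; unfold r; destruct name_eq_dec;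
      intuition congruence. }
  induction p as [|a b|a b p IH|a p IH|p IHp q IHq|p IH]; simpl; intros H; auto.
  - f_equal; destruct (name_eq_dec b y) as [->|]; auto.
    rewrite IH, S; auto.
  - destruct (name_eq_dec a y) as [->|]; auto.
    rewrite IH, S; auto.
  - rewrite map_app, IHp, IHq; auto.
Qed.

Lemma free_occs_alpha p q : alpha p q -> free_occs p = free_occs q.
Proof.
  assert (B : forall y y' r, ~ occurs y' r ->
    remv y (free_occs r) = remv y' (free_occs (subst y' y r))).
  { intros y y' r H; rewrite free_occs_subst, (remv_map _ y) by
      (auto; intros x Hx; apply in_free_occs, free_occurs in Hx;
       destruct name_eq_dec; intuition congruence).
    rewrite <- map_id at 1; apply map_ext_in; intros x Hx.
    apply in_remv in Hx; destruct name_eq_dec; tauto. }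
  induction 1; simpl; try congruence; auto.
  f_equal; auto.
Qed.

Lemma rename_ext p : forall f g, (forall x, f x = g x) -> rename f p = rename g p.
Proof.
  induction p; simpl; intros f g H; rewrite ?H; f_equal; auto; apply IHp;
    intros x; unfold fupd; destruct name_eq_dec; auto.
Qed.

Lemma rename_act p f : (forall b, bound_in b p -> f b = b) -> rename f p = act f p.
Proof.
  assert (U : forall b q, f b = b -> rename (fupd f b) q = rename f q).
  { intros b q E; apply rename_ext; intros x; unfold fupd; destruct name_eq_dec; congruence. }
  induction p as [|a b|a b p IH|a p IH|p IHp q IHq|p IH]; simpl; intros H; auto.
  - rewrite (U b), IH, (H b) by auto; reflexivity.
  - rewrite (U a), IH, (H a) by auto; reflexivity.
  - rewrite IHp, IHq; auto.
  - rewrite IH; auto.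
Qed.

(** The least positive period [h] of [i] gives [h] distinct iterates, which cover all nodes by the
    single orbit; counting yields [h = k]. *)
Lemma orbit_period k sN : (forall i, node k i -> node k (sN i)) ->
  (forall i j, node k i -> node k j -> sN i = sN j -> i = j) -> single_orbit k sN ->
  forall i, node k i -> Nat.iter k sN i = i /\
    (forall a b, a < k -> b < k -> Nat.iter a sN i = Nat.iter b sN i -> a = b) /\
    (forall j, node k j -> exists a, a < k /\ Nat.iter a sN i = j).
Proof.
  intros Hn Hinj Horb i Hi.
  assert (Hit : forall a, node k (Nat.iter a sN i)) by (induction a; simpl; auto).
  assert (Hcan : forall a j, node k j -> Nat.iter a sN i = Nat.iter a sN j -> i = j).
  { intros a j Hj E; assert (Hjt : forall b, node k (Nat.iter b sN j))
      by (induction b; simpl; auto).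
    induction a; simpl in E; auto. }
  assert (Hmin : exists h, 0 < h /\ Nat.iter h sN i = i /\
    forall h', 0 < h' -> Nat.iter h' sN i = i -> h <= h').
  (* Returning to [i] from [sN i] rather than from [i] makes the period positive. *)
  { destruct (Horb (sN i) i) as [m Hm]; auto.
    rewrite <- Nat.iter_succ_r in Hm.
    assert (Hp : 0 < S m) by lia; revert Hp Hm; generalize (S m) as n.
    induction n as [n IH] using lt_wf_ind; intros Hp Hm.
    destruct (classic (exists h', h' < n /\ 0 < h' /\ Nat.iter h' sN i = i))
      as [[h' [H1 [H2 H3]]]|Hno]; [eauto|].
    exists n; repeat split; auto; intros h' H2 H3.
    destruct (Nat.le_gt_cases n h'); auto; exfalso; apply Hno; eauto. }
  destruct Hmin as [h [Hh [Eh Hmin]]].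
  assert (Hdist : forall a b, a < h -> b < h -> Nat.iter a sN i = Nat.iter b sN i -> a = b).
  { assert (D : forall a b, a < b -> b < h -> Nat.iter a sN i = Nat.iter b sN i -> False).
    { intros a b Hab Hb E; replace b with (a + (b - a)) in E by lia.
      rewrite Nat.iter_add in E; apply Hcan in E; [|apply Hit].
      symmetry in E; apply Hmin in E; lia. }
    intros a b Ha Hb E; destruct (Nat.lt_total a b) as [L|[->|L]]; auto; exfalso; eauto. }
  assert (Hmod : forall a, exists b, b < h /\ Nat.iter b sN i = Nat.iter a sN i).
  { induction a as [|a [b [Hb E]]]; [exists 0; auto|].
    destruct (Nat.eq_dec (S b) h) as [Eb|].
    - exists 0; split; [lia|]; simpl; rewrite <- E.
      change (sN (Nat.iter b sN i)) with (Nat.iter (S b) sN i); rewrite Eb; auto.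
    - exists (S b); split; [lia|]; simpl; congruence. }
  assert (Hcov : forall j, node k j -> exists a, a < h /\ Nat.iter a sN i = j).
  { intros j Hj; destruct (Horb i j Hi Hj) as [m <-]; apply Hmod. }
  assert (E : h = k).
  { set (O := map (fun a => Nat.iter a sN i) (seq 0 h)).
    assert (HO : NoDup O).
    { apply NoDup_map_NoDup_ForallPairs; [|apply seq_NoDup].
      intros a b Ha Hb; apply in_seq in Ha, Hb; apply Hdist; lia. }
    assert (H1 : length O <= length (seq 1 k)).
    { apply NoDup_incl_length; auto; intros j Hj; apply in_map_iff in Hj as [a [<- _]].
      apply in_seq; specialize (Hit a); unfold node in Hit; lia. }
    assert (H2 : length (seq 1 k) <= length O).
    { apply NoDup_incl_length; [apply seq_NoDup|]; intros j Hj; apply in_seq in Hj.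
      destruct (Hcov j) as [a [Ha <-]]; [unfold node; lia|].
      apply (in_map (fun a => Nat.iter a sN i)), in_seq; lia. }
    unfold O in *; rewrite length_map, !length_seq in *; lia. }
  subst h; auto.
Qed.

(* Extends [f] by infinitely many [k]-cycles on the variables from [N] on, so
   that fresh names with a fresh orbit are always available. *)
Definition cycle_ext (k N : nat) (f : name -> name) (x : name) : name :=
  match x with
  | NVar n => if n <? N then f x
              else NVar (N + (k * ((n - N) / k) + S ((n - N) mod k) mod k))
  | _ => f x
  end.

Definition low (N : nat) (x : name) : Prop := forall n, x = NVar n -> n < N.

Lemma cycle_ext_low k N f x : low N x -> cycle_ext k N f x = f x.
Proof.
  intros H; destruct x as [| |n]; simpl; auto.
  specialize (H n eq_refl); destruct (Nat.ltb_spec n N); auto; lia.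
Qed.

Lemma iter_cycle_ext_low k N f x a : (forall x, low N x -> low N (f x)) -> low N x ->
  low N (Nat.iter a f x) /\ Nat.iter a (cycle_ext k N f) x = Nat.iter a f x.
Proof.
  intros Hf Hx; induction a as [|a [IH1 IH2]]; simpl; auto; split; auto.
  rewrite IH2; apply cycle_ext_low; auto.
Qed.

Lemma iter_cycle_ext_high k N f q r a : r < k ->
  Nat.iter a (cycle_ext k N f) (NVar (N + (k * q + r))) = NVar (N + (k * q + (r + a) mod k)).
Proof.
  intros Hr; induction a as [|a IH].
  - rewrite Nat.add_0_r, Nat.mod_small by auto; reflexivity.
  - simpl; rewrite IH; simpl.
    set (r' := (r + a) mod k).
    assert (Hr' : r' < k) by (apply Nat.mod_upper_bound; lia).
    replace (N + (k * q + r') - N) with (k * q + r') by lia.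
    replace ((k * q + r') / k) with q by (apply (Nat.div_unique _ _ _ r'); lia).
    replace ((k * q + r') mod k) with r' by (apply (Nat.mod_unique _ _ q r'); lia).
    destruct (Nat.ltb_spec (N + (k * q + r')) N); [lia|].
    do 3 f_equal.
    replace (S r') with (r' + 1) by lia; unfold r'.
    rewrite Nat.Div0.add_mod_idemp_l; f_equal; lia.
Qed.

Lemma single_orbit_symmetry k P sN sX : automorphism k P sN sX ->
  ~ is_identity k P sN sX -> single_orbit k sN -> symmetric k P sN sX -> 1 <= k ->
  exists pi, cyclic_symmetry k sN pi /\ invariant k sN pi (NS [] P).
Proof.
  intros [HN1 [HN2 [HN3 [HX1 [HX2 [HX3 HX4]]]]]] Hid Horb Hsym Hk.
  pose proof (orbit_period k sN HN1 HN2 Horb) as Hper.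
  assert (H1 : node k 1) by (unfold node; lia).
  (* Symmetry provides a renaming for each node separately; [sigma_renaming] determines its values,
     so the one found at node 1 serves everywhere. *)
  destruct (Hsym 1 H1) as [R1 [[f [Q1 [Hf _]]] _]].
  assert (Huniq : forall g, sigma_renaming k P sN sX g -> forall x, g x = f x).
  { intros g Hg x; destruct (Hf x) as [F1 [F2 F3]], (Hg x) as [G1 [G2 G3]].
    destruct (classic (exists i, x = NNat i /\ node k i)) as [[i [E Hi]]|Hno].
    - rewrite (F1 i E Hi), (G1 i E Hi); reflexivity.
    - assert (Hno' : forall i, x = NNat i -> ~ node k i) by (intros i E Hi; apply Hno; eauto).
      destruct (classic (arc k P x)); [rewrite F2, G2 | rewrite F3, G3]; auto. }
  (* The bound names introduced by the initial alpha-renaming are of this kind: fixed by [f] and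
     without another preimage, they are never confused with other names, although [f] is not yet
     known to be injective. *)
  assert (Hfresh : forall b, fresh_name k P b -> f b = b /\ forall x, f x = b -> x = b).
  { intros b [Hb1 [Hb2 Hb3]].
    assert (Hba : ~ arc k P b) by (intros [_ [i [Hi K]]]; exact (Hb3 i Hi K)).
    split; [apply (Hf b); auto|]; intros x E; destruct (Hf x) as [F1 [F2 F3]].
    destruct (classic (exists i, x = NNat i /\ node k i)) as [[i [Ei Hi]]|Hno].
    - rewrite (F1 i Ei Hi) in E; exfalso; apply (Hb2 (sN i)); auto.
    - assert (Hno' : forall i, x = NNat i -> ~ node k i) by (intros i Ei Hi; apply Hno; eauto).
      destruct (classic (arc k P x)) as [Ha|Ha]; [|rewrite F3 in E; auto].
      rewrite F2 in E by auto; exfalso; apply Hba; rewrite <- E; auto. }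
  assert (Himg : forall i, node k i -> exists Q, alpha (P i) Q /\
    (forall b, bound_in b Q -> fresh_name k P b) /\ alpha (P (sN i)) (act f Q)).
  { intros i Hi; destruct (Hsym i Hi) as [R [[g [Q [Hg [Ha [Hb ->]]]]] HR]].
    exists Q; split; [|split]; auto.
    rewrite (rename_ext Q g f (Huniq g Hg)), rename_act in HR; auto.
    intros b Kb; exact (proj1 (Hfresh b (Hb b Kb))). }
  (* Since alpha-conversion preserves the list of free occurrences, going once
     around the orbit shows that [f^k] fixes every free name; this also yields
     the injectivity of [f]. *)
  assert (Hocc : forall a i, node k i ->
    free_occs (P (Nat.iter a sN i)) = map (Nat.iter a f) (free_occs (P i))).
  { intros a i Hi; induction a as [|a IH]; simpl; [symmetry; apply map_id|].
    assert (Hai : node k (Nat.iter a sN i)) by (clear IH; induction a; simpl; auto).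
    destruct (Himg _ Hai) as [Q [Ha [Hb HQ]]].
    rewrite (free_occs_alpha _ _ HQ), free_occs_act.
    - rewrite <- (free_occs_alpha _ _ Ha), IH, map_map; reflexivity.
    - intros b Kb x E; destruct (Hfresh b (Hb b Kb)) as [Eb Hx].
      apply Hx; congruence. }
  assert (Hfk : forall x, Nat.iter k f x = x).
  { intros x; destruct (classic (exists i, x = NNat i /\ node k i)) as [[i [-> Hi]]|Hno].
    - assert (E : forall a, Nat.iter a f (NNat i) = NNat (Nat.iter a sN i) /\
         node k (Nat.iter a sN i)).
      { induction a as [|a [IH IHn]]; simpl; auto; split; auto.
        rewrite IH; apply (Hf (NNat (Nat.iter a sN i))); auto. }
      rewrite (proj1 (E k)), (proj1 (Hper i Hi)); reflexivity.
    - assert (Hno' : forall i, x = NNat i -> ~ node k i) by (intros i Ei Hi; apply Hno; eauto).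
      destruct (classic (arc k P x)) as [[_ [i [Hi Hx]]]|Ha].
      + pose proof (Hocc k i Hi) as E; rewrite (proj1 (Hper i Hi)) in E.
        apply in_free_occs in Hx; revert E Hx; generalize (free_occs (P i)) as L.
        induction L as [|y L IH]; simpl; intros E Hx; [tauto|].
        injection E as E1 E2; destruct Hx as [->|Hx]; auto.
      + assert (E : f x = x) by (apply (Hf x); auto).
        clear - E; induction k; simpl; congruence. }
  assert (Hfi : inj f) by (apply (iter_period_inj k); auto).
  (* With a single node, [f] has order one, and both parts of sigma would be trivial. *)
  assert (Hk2 : 2 <= k).
  { destruct (Nat.eq_dec k 1) as [E|]; [exfalso|lia]; subst k.
    apply Hid; simpl in Hfk; split; [intros i Hi; apply HN1 in Hi as Hi'; unfold node in *; lia|].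
    assert (Hvar : forall x, arc 1 P x -> x <> NNat 1 -> sX x = x).
    { intros x Hx Hx1; rewrite <- (Hfk x) at 2; symmetry; apply (Hf x); auto.
      intros i -> Hi; apply Hx1; f_equal; unfold node in Hi; lia. }
    (* On a node identifier [f] follows [sN] and says nothing about [sX]. But [sX] fixes all other
       arcs, so its injectivity leaves this arc no other value. *)
    intros x Hx; destruct (name_eq_dec x (NNat 1)) as [->|Hx1]; auto.
    destruct (name_eq_dec (sX (NNat 1)) (NNat 1)) as [|Hne]; auto. }
  destruct (nvar_bound (flat_map (fun j => nms (P j)) (seq 1 k))) as [N HNb].
  assert (Hlow : forall i x, node k i -> free_in x (P i) -> low N x).
  { intros i x Hi Hx n ->; apply HNb, in_flat_map; exists i; split; [|apply free_nms, Hx].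
    apply in_seq; unfold node in Hi; lia. }
  assert (Hfix : forall n, N <= n -> f (NVar n) = NVar n).
  { intros n Hn; apply (Hf (NVar n)); [discriminate|].
    intros [_ [i [Hi K]]]; specialize (Hlow _ _ Hi K n eq_refl); lia. }
  assert (Hflow : forall x, low N x -> low N (f x)).
  { intros x Hx n E; destruct (Nat.le_gt_cases N n) as [Hn|]; auto.
    rewrite <- (Hfix n Hn) in E; apply Hfi in E; auto. }
  set (pi := cycle_ext k N f).
  assert (Hnn : forall x, (forall n, x <> NVar n) -> pi x = f x).
  { intros x Hx; apply cycle_ext_low; intros n E; destruct (Hx n E). }
  assert (Hpk : forall x, Nat.iter k pi x = x).
  { intros x; destruct (classic (low N x)) as [Hx|Hx].
    - destruct (iter_cycle_ext_low k N f x k Hflow Hx) as [_ E]; unfold pi; rewrite E; auto.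
    - assert (Hn : exists n, x = NVar n /\ N <= n).
      { apply NNPP; intros K; apply Hx; intros n E.
        destruct (Nat.le_gt_cases N n); auto; exfalso; eauto. }
      destruct Hn as [n [-> Hn]].
      assert (En : n = N + (k * ((n - N) / k) + (n - N) mod k))
        by (rewrite <- Nat.div_mod; lia).
      assert (Hm : (n - N) mod k < k) by (apply Nat.mod_upper_bound; lia).
      rewrite En; unfold pi; rewrite iter_cycle_ext_high by auto; do 3 f_equal.
      rewrite <- (Nat.mul_1_l k) at 2; rewrite Nat.Div0.mod_add; apply Nat.mod_small; auto. }
  assert (Hpi : inj pi) by (apply (iter_period_inj k); auto).
  exists pi; split; [split|split]; auto.
  - intros i Hi; exact (proj1 (Hper i Hi)).
  - intros i a b Hi; exact (proj1 (proj2 (Hper i Hi)) a b).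
  - intros i j Hi; exact (proj2 (proj2 (Hper i Hi)) j).
  - rewrite Hnn by discriminate; apply (Hf NO); [discriminate|].
    intros [K _]; congruence.
  - intros i Hi; rewrite Hnn by discriminate; apply (Hf (NNat i)); auto.
  - intros F; destruct (nvar_bound F) as [M HM].
    (* The cycle numbered [M] works: its variables have index at least [k * M >= M], beyond all
       those of [F]. *)
    exists (NVar (N + (k * M + 0))); split.
    + intros a; unfold pi; rewrite iter_cycle_ext_high by lia; intros K; apply HM in K; nia.
    + intros a b Ha Hb; unfold pi; rewrite !iter_cycle_ext_high by lia.
      rewrite !Nat.add_0_l, !Nat.mod_small by lia; intros E; injection E; lia.
  - intros i Hi; destruct (Himg i Hi) as [Q [Ha [_ HQ]]]; apply sc_alpha.
    eapply al_trans; [exact HQ|].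
    eapply al_trans; [apply alpha_act, al_sym, Ha; auto|].
    apply act_agree_alpha; auto; intros x Hx; symmetry; apply cycle_ext_low; eauto.
Qed.

(** * The infinite symmetric computation *)

Definition nsteps_default : label * contrib * nstate := (Tau, fun _ => None, NS [] (fun _ => Nil)).

Definition comp_of (s : nstate) (len : option nat) (g : nat -> label * contrib * nstate) : comp :=
  Comp len (fun m => match m with 0 => s | S m => snd (g m) end)
    (fun m => fst (fst (g m))) (fun m => snd (fst (g m))).

Definition step_at (L : nsteps) (m : nat) : label * contrib * nstate := nth m L nsteps_default.

Lemma run_last k s L t : run k s L t ->
  match length L with 0 => s | S m => snd (step_at L m) end = t.
Proof.
  intros [|L' t' mu K u _ _]; auto.
  rewrite length_app, Nat.add_comm; simpl.
  unfold step_at; rewrite app_nth2, Nat.sub_diag by lia; reflexivity.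
Qed.

Lemma run_step k s L t : run k s L t -> forall m len, m < length L ->
  let C := comp_of s len (step_at L) in
  nstep k (cst C m) (clab C m) (ccon C m) (cst C (S m)).
Proof.
  induction 1 as [|L t mu K u Hr IH Hs]; intros m len Hm; simpl in Hm; [lia|].
  rewrite length_app in Hm; simpl in Hm; simpl.
  assert (Hold : forall m, m < length L -> step_at (L ++ [(mu, K, u)]) m = step_at L m)
    by (intros; apply app_nth1; auto).
  destruct (Nat.eq_dec m (length L)) as [->|Hne].
  - assert (Hnew : step_at (L ++ [(mu, K, u)]) (length L) = (mu, K, u))
      by (unfold step_at; rewrite app_nth2, Nat.sub_diag by lia; reflexivity).
    rewrite Hnew; simpl; rewrite <- (run_last _ _ _ _ Hr) in Hs.
    destruct (length L); auto; rewrite Hold by lia; exact Hs.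
  - specialize (IH m len ltac:(lia)); simpl in IH.
    rewrite Hold by lia; destruct m; auto; rewrite Hold by lia; exact IH.
Qed.

Definition outputs_closed (pi : name -> name) (C : comp) : Prop :=
  forall i v, proj_has_out C i v -> exists j, proj_has_out C j (pi v).

(** With [extends], the second hypothesis forces both computations to have the same steps, hence the
    same projections. *)
Lemma extends_outputs_closed pi C C' : extends C C' ->
  (forall m, step_in (clen C') m -> step_in (clen C) m) ->
  outputs_closed pi C -> outputs_closed pi C'.
Proof.
  intros [Hl [_ He]] Hback Hc i v [m [p [p' [Hm E]]]].
  destruct (Hc i v) as [j [m' [q [q' [Hm' E']]]]].
  { exists m, p, p'; split; auto; destruct (He m) as [_ [-> _]]; auto. }
  exists j, m', q, q'; split.
  - destruct (clen C), (clen C'); simpl in *; auto; lia.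
  - destruct (He m') as [_ [<- _]]; auto.
Qed.

Lemma extends_refl C : extends C C.
Proof.
  split; [destruct (clen C); simpl; auto | split; auto].
Qed.

Definition elects (k : nat) (P : nat -> proc) (C : comp) (n : nat) : Prop :=
  node k n /\ (forall i, node k i -> proj_has_out C i (NNat n)) /\
  (forall C', is_comp k P C' -> extends C C' ->
     forall i v, proj_has_out C' i v -> v = NNat n).

(** [C] is its own extension, yet it announces [sN n] along with [n]; the two differ since an orbit
    of length at least two has no fixed point. *)
Lemma outputs_closed_not_elects k P sN pi C n : cyclic_symmetry k sN pi ->
  is_comp k P C -> outputs_closed pi C -> ~ elects k P C n.
Proof.
  intros H HC Hcl [Hn [Hall Honly]].
  destruct (Hcl n (NNat n) (Hall n Hn)) as [j Hj].
  apply (Honly C HC (extends_refl C)) in Hj.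
  rewrite (cs_pi_node _ _ _ H n Hn) in Hj; injection Hj as Hj.
  pose proof (cs_ge2 _ _ _ H).
  pose proof (cs_distinct _ _ _ H n 1 0 Hn ltac:(lia) ltac:(lia) Hj); lia.
Qed.

Definition symmetric_run (k : nat) (P : nat -> proc) (sN : nat -> nat) (pi : name -> name)
  (L : nsteps) : Prop :=
  exists t, run k (NS [] P) L t /\ invariant k sN pi t /\ announcement_closed pi L.

Lemma announced_step_at L m i p v p' : m < length L ->
  snd (fst (step_at L m)) i = Some (p, LOut NO v, p') -> announced L v.
Proof.
  intros Hm E; pose proof (nth_In L nsteps_default Hm) as Hin.
  change (nth m L nsteps_default) with (step_at L m) in Hin.
  destruct (step_at L m) as [[mu K] u]; exists mu, K, u, i, p, p'; auto.
Qed.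

Lemma announced_proj s len g L v : announced L v ->
  (forall m, m < length L -> step_in len m /\ g m = step_at L m) ->
  exists i, proj_has_out (comp_of s len g) i v.
Proof.
  intros [mu [K [u [i [p [p' [Hin E]]]]]]] Hg.
  destruct (In_nth _ _ nsteps_default Hin) as [m [Hm Em]].
  destruct (Hg m Hm) as [Hl Eg].
  exists i, m, p, p'; split; auto; simpl; rewrite Eg; unfold step_at; rewrite Em; exact E.
Qed.

(** If the extension promised by the election continues past [L], its next step starts a round and
    the rest of it is discarded. If it adds nothing, the run [L] would already elect, against its
    closure under [pi]. *)
Lemma symmetric_run_extend k P sN pi L : cyclic_symmetry k sN pi -> electoral k P ->
  symmetric_run k P sN pi L ->
  exists L', L' <> [] /\ symmetric_run k P sN pi (L ++ L').
Proof.
  intros H Hel [t [Hr [Hinv Hcl]]].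
  set (C := comp_of (NS [] P) (Some (length L)) (step_at L)).
  assert (HC : is_comp k P C).
  { split; auto; intros m Hm; apply (run_step _ _ _ _ Hr m (Some (length L)) Hm). }
  destruct (Hel C HC) as [C' [HC' [Hext [n Hn]]]].
  destruct (classic (step_in (clen C') (length L))) as [Hst|Hst].
  - assert (Et : cst C' (length L) = t).
    { rewrite <- (run_last _ _ _ _ Hr); destruct Hext as [_ [E0 He]].
      destruct (length L) as [|m] eqn:El; [symmetry; exact E0|].
      destruct (He m) as [_ [_ E]]; [simpl; lia | symmetry; exact E]. }
    pose proof (proj2 HC' _ Hst) as Hstep; rewrite Et in Hstep.
    destruct (round _ _ _ _ _ _ _ H Hinv Hstep) as [L' [u [Hr' [Hinv' [Hne Hcl']]]]].
    exists L'; split; auto; exists u; split; [eapply run_app; eauto|split; auto].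
    intros v; rewrite !announced_app; intros [|]; auto.
  - exfalso; apply (outputs_closed_not_elects k P sN pi C' n H HC'); [|exact Hn].
    apply (extends_outputs_closed pi C C' Hext).
    + intros m Hm; simpl; destruct (clen C'); simpl in *; [lia|tauto].
    + intros i v [m [p [p' [Hm E]]]].
      apply (announced_proj _ _ _ L); [|intros; split; auto].
      apply Hcl; eapply announced_step_at; [exact Hm | exact E].
Qed.

Theorem mainTheorem2 (k : nat) (P : nat -> proc)
  (sN : nat -> nat) (sX : name -> name) :
  automorphism k P sN sX ->
  ~ is_identity k P sN sX ->
  single_orbit k sN ->
  symmetric k P sN sX ->
  ~ electoral k P.
Proof.
  intros Haut Hid Horb Hsym Hel.
  (* The empty computation has an extension with an elected node, so there is at least one node. *)
  assert (Hk : 1 <= k).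
  { destruct (Hel (comp_of (NS [] P) (Some 0) (step_at []))) as [C' [_ [_ [n [Hn _]]]]].
    - split; auto; simpl; intros; lia.
    - unfold node in Hn; lia. }
  destruct (single_orbit_symmetry k P sN sX Haut Hid Horb Hsym Hk) as [pi [H Hinv]].
  (* Each run is paired with its proof of symmetry, so that choice yields a function that can be
     iterated. *)
  assert (Hnext : forall L : {L | symmetric_run k P sN pi L},
    exists L' : {L | symmetric_run k P sN pi L},
      exists D, D <> [] /\ proj1_sig L' = proj1_sig L ++ D).
  { intros [L HL]; destruct (symmetric_run_extend _ _ _ _ L H Hel HL) as [D [HD HLD]].
    exists (exist _ _ HLD); eauto. }
  assert (H0 : symmetric_run k P sN pi []).
  { exists (NS [] P); split; [apply run_nil|split; auto].
    intros v [? [? [? [? [? [? [[] _]]]]]]]. }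
  set (next := fun L => proj1_sig (constructive_indefinite_description _ (Hnext L))).
  set (G := fun n => proj1_sig (Nat.iter n next (exist _ [] H0))).
  assert (Hgood : forall n, symmetric_run k P sN pi (G n)).
  { intros n; apply (proj2_sig (Nat.iter n next (exist _ [] H0))). }
  assert (HGS : forall n, exists D, D <> [] /\ G (S n) = G n ++ D).
  { intros n; unfold G; simpl; unfold next at 1.
    destruct constructive_indefinite_description as [L' HL']; exact HL'. }
  assert (Hlen : forall n, n <= length (G n)).
  { induction n as [|n IH]; [lia|]; destruct (HGS n) as [D [HD ->]].
    rewrite length_app; destruct D; [congruence|simpl; lia]. }
  assert (Hpre : forall n m j, m < length (G n) -> n <= j -> step_at (G j) m = step_at (G n) m /\
    m < length (G j)).
  { intros n m j Hm Hj; induction Hj as [|j Hj [IH1 IH2]]; auto.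
    destruct (HGS j) as [D [_ ->]]; rewrite length_app; split; [|lia].
    rewrite <- IH1; apply app_nth1; auto. }
  (* [G n] has at least [n] steps, so step [m] is certain to exist in [G (S m)]; later runs do not
     change it. *)
  set (g := fun m => step_at (G (S m)) m).
  assert (Hg : forall n m, m < length (G n) -> g m = step_at (G n) m).
  { intros n m Hm; unfold g; destruct (Nat.le_ge_cases n (S m)) as [Hle|Hle].
    - apply Hpre; auto.
    - symmetry; apply Hpre; auto; apply (Hlen (S m)). }
  set (C := comp_of (NS [] P) None g).
  assert (HC : is_comp k P C).
  { split; auto; intros m _.
    destruct (Hgood (S m)) as [t [Hr _]].
    pose proof (run_step _ _ _ _ Hr m None (Hlen (S m))) as Hst; simpl in Hst |- *.
    rewrite !(Hg (S m)) by apply (Hlen (S m)).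
    destruct m as [|m]; [exact Hst|].
    rewrite (Hg (S (S m)) m) by (pose proof (Hlen (S (S m))); lia); exact Hst. }
  assert (Hcl : outputs_closed pi C).
  { intros i v [m [p [p' [_ E]]]].
    destruct (Hgood (S m)) as [t [_ [_ Hcl]]].
    apply (announced_proj _ _ _ (G (S m))); [|intros j Hj; split; simpl; auto].
    apply Hcl; eapply announced_step_at; [apply (Hlen (S m)) | exact E]. }
  destruct (Hel C HC) as [C' [HC' [Hext [n Hn]]]].
  apply (outputs_closed_not_elects k P sN pi C' n H HC'); [|exact Hn].
  (* [C] is infinite, so its extension [C'] has no step beyond those of [C]. *)
  apply (extends_outputs_closed pi C C' Hext); simpl; auto.
Qed.
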